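(* Consider the two-user IM/DD interference channel in the strong interference regime $h_{12}\ge h_{11}>0$ and $h_{21}\ge h_{22}>0$, with $\alpha_1=\alpha_2=\alpha\in(0,1]$. Let $\mathcal{G}'_{\rm Z}$ be the set of all $(\mathsf{R}_1,\mathsf{R}_2)\in\mathbb{R}_+^2$ such that, for both choices $i,j\in\{1,2\}$, $i\neq j$, $$\mathsf{R}_i\le\overline{\mathsf{C}}(h_{ii}\mathsf{A},\alpha),$$ $$\mathsf{R}_1+\mathsf{R}_2\le\overline{\mathsf{C}}\big((h_{ii}+h_{ji})\mathsf{A},\alpha\big)-\min\Big\{0,\tfrac12\log\Big(\max\Big\{\tfrac{h_{ji}^2}{h_{jj}^2},\ \tfrac{1-h_{ji}^2/h_{jj}^2}{2^{2\overline{\mathsf{C}}(h_{jj}\mathsf{A},\alpha)}}\Big\}\Big)\Big\}.$$ Then, given $(\mathsf{R}_1,\mathsf{R}_2)\in\mathcal{G}'_{\rm Z}$ and $\epsilon>0$, the rate pair $(\mathsf{R}_1-\frac12-\epsilon,\ \mathsf{R}_2-\frac12-\epsilon)$ is achievable (i.e., lies in the capacity region $\mathcal{G}$) when $\frac{\mathsf{A}}{\sigma}$ is sufficiently large.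
   Context: Two-user IM/DD interference channel: for $i,j\in\{1,2\}$, $i\neq j$, at each time instant $Y_i=h_{ii}X_i+h_{ji}X_j+Z_i$, where $h_{kl}\ge0$ are channel gains, $Z_1,Z_2\sim\mathcal{N}(0,\sigma^2)$ ($\sigma>0$), i.i.d. over time and independent of the inputs. Inputs satisfy $X_i\in[0,\mathsf{A}]$ ($\mathsf{A}>0$) and $\mathbb{E}[X_i]\le\alpha_i\mathsf{A}$, $\alpha_i\in(0,1]$. Transmitter $i$ encodes $m_i\in\{1,\dots,\lceil2^{n\mathsf{R}_i}\rceil\}$ into a length-$n$ codeword satisfying these constraints; receiver $i$ decodes $m_i$ from $Y_i^n$; $(\mathsf{R}_1,\mathsf{R}_2)$ is achievable if there are codes with both average error probabilities tending to $0$; the capacity region $\mathcal{G}$ is the closure of the achievable pairs (a pair with a negative coordinate is regarded as achievable when it is componentwise dominated by a point of $\mathcal{G}$). Logarithms are base 2, and $\mathcal{Q}(x)=\int_x^\infty\frac{1}{\sqrt{2\pi}}e^{-t^2/2}dt$. The function $\overline{\mathsf{C}}(\mathsf{A},\alpha)$ (an upper bound on the capacity of the point-to-point channel $Y=X+Z$, $Z\sim\mathcal{N}(0,\sigma^2)$, $X\in[0,\mathsf{A}]$, $\mathbb{E}[X]\le\alpha\mathsf{A}$) is defined as $c_1$ if $\alpha\in(0,\frac12)$ and $c_2$ if $\alpha\in[\frac12,1]$, where $$c_1=\min_{\mu,\xi>0}\Big[1-\mathcal{Q}\big(\tfrac{\xi+\alpha\mathsf{A}}{\sigma}\big)-\m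athcal{Q}\big(\tfrac{\xi+(1-\alpha)\mathsf{A}}{\sigma}\big)\Big]\log\Big(\frac{\mathsf{A}}{\sigma}\frac{e^{\mu\xi/\mathsf{A}}-e^{-\mu(1+\xi/\mathsf{A})}}{\sqrt{2\pi}\,\mu\,(1-2\mathcal{Q}(\xi/\sigma))}\Big)+\log(e)\Big[-\tfrac12+\mathcal{Q}\big(\tfrac{\xi}{\sigma}\big)+\tfrac{\xi}{\sqrt{2\pi}\sigma}e^{-\frac{\xi^2}{2\sigma^2}}+\tfrac{\sigma}{\mathsf{A}}\tfrac{\mu}{\sqrt{2\pi}}\big(e^{-\frac{\xi^2}{2\sigma^2}}-e^{-\frac{(\mathsf{A}+\xi)^2}{2\sigma^2}}\big)+\mu\alpha\big(1-2\mathcal{Q}\big(\tfrac{\xi+\mathsf{A}/2}{\sigma}\big)\big)\Big],$$ $$c_2=\min_{\xi>0}\Big[1-2\mathcal{Q}\big(\tfrac{\xi+\mathsf{A}/2}{\sigma}\big)\Big]\log\Big(\frac{\mathsf{A}+2\xi}{\sigma\sqrt{2\pi}(1-2\mathcal{Q}(\xi/\sigma))}\Big)+\log(e)\Big[-\tfrac12+\mathcal{Q}\big(\tfrac{\xi}{\sigma}\big)+\tfrac{\xi}{\sqrt{2\pi}\sigma}e^{-\frac{\xi^2}{2\sigma^2}}\Big].$$ *)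

(* Defs.v *)
From HB Require Import structures.
From mathcomp Require Import all_boot all_order all_algebra.
From mathcomp Require Import all_classical all_reals all_analysis.

Set Implicit Arguments.
Unset Strict Implicit.
Unset Printing Implicit Defensive.

Import Order.TTheory GRing.Theory Num.Theory.
Import numFieldNormedType.Exports.
Local Open Scope classical_set_scope.
Local Open Scope ring_scope.

Section IMDD.
Variable R : realType.

Definition log2 (x : R) : R := ln x / ln 2.

Definition Qfun (x : R) : R :=
  fine (\int[lebesgue_measure]_(t in `[x, +oo[)
          ((Num.sqrt (pi *+ 2))^-1 * expR (- (t ^+ 2) / 2))%:E)%E.

Definition c1_obj (sigma A alpha mu xi : R) : R :=
  (1 - Qfun ((xi + alpha * A) / sigma) - Qfun ((xi + (1 - alpha) * A) / sigma))
  * log2 ((A / sigma) *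
          ((expR (mu * xi / A) - expR (- (mu * (1 + xi / A)))) /
           (Num.sqrt (pi *+ 2) * mu * (1 - 2 * Qfun (xi / sigma)))))
  + log2 (expR 1) *
    (- (1/2) + Qfun (xi / sigma)
     + xi / (Num.sqrt (pi *+ 2) * sigma) * expR (- (xi ^+ 2) / (2 * sigma ^+ 2))
     + (sigma / A) * (mu / Num.sqrt (pi *+ 2)) *
         (expR (- (xi ^+ 2) / (2 * sigma ^+ 2))
          - expR (- ((A + xi) ^+ 2) / (2 * sigma ^+ 2)))
     + mu * alpha * (1 - 2 * Qfun ((xi + A / 2) / sigma))).

Definition c2_obj (sigma A xi : R) : R :=
  (1 - 2 * Qfun ((xi + A / 2) / sigma))
  * log2 ((A + 2 * xi) /
          (sigma * Num.sqrt (pi *+ 2) * (1 - 2 * Qfun (xi / sigma))))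
  + log2 (expR 1) *
    (- (1/2) + Qfun (xi / sigma)
     + xi / (Num.sqrt (pi *+ 2) * sigma) * expR (- (xi ^+ 2) / (2 * sigma ^+ 2))).

Definition c1 (sigma A alpha : R) : R :=
  inf [set y | exists mu xi, [/\ 0 < mu, 0 < xi & y = c1_obj sigma A alpha mu xi]].

Definition c2 (sigma A : R) : R :=
  inf [set y | exists xi, 0 < xi /\ y = c2_obj sigma A xi].

Definition Cbar (sigma A alpha : R) : R :=
  if alpha < 1/2 then c1 sigma A alpha else c2 sigma A.

(** Law of Y^n = mu + Z^n with Z_t i.i.d. N(0, sigma^2):
    gexp sigma n mu f = E[f(Y^n)] for nonnegative f, computed as an
    iterated integral against the product of the N(mu_t, sigma^2) laws. *)
Fixpoint gexp (sigma : R) (n : nat) : (nat -> R) -> (n.-tuple R -> \bar R) -> \bar R :=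
  match n return (nat -> R) -> (n.-tuple R -> \bar R) -> \bar R with
  | 0 => fun mu f => f [tuple]
  | k.+1 => fun mu f =>
      (\int[normal_prob (mu 0%N) sigma]_z
         @gexp sigma k (fun t => mu t.+1) (fun s => f (cons_tuple z s)))%E
  end.

Definition gprob (sigma : R) (n : nat) (mu : nat -> R) (S : set (n.-tuple R)) : R :=
  fine (@gexp sigma n mu (fun y => (\1_S y)%:E)).

Definition nmsg (n : nat) (r : R) : nat := `|Num.ceil (2 `^ (n%:R * r))|%N.

Record code (A alpha1 alpha2 : R) (n M1 M2 : nat) := Code {
  enc1 : 'I_M1 -> n.-tuple R;
  enc2 : 'I_M2 -> n.-tuple R;
  dec1 : n.-tuple R -> 'I_M1;
  dec2 : n.-tuple R -> 'I_M2;
  enc1_peak : forall m t, 0 <= nth 0 (enc1 m : seq R) t <= A;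
  enc2_peak : forall m t, 0 <= nth 0 (enc2 m : seq R) t <= A;
  enc1_avg : forall m, \sum_(t < n) nth 0 (enc1 m : seq R) t <= n%:R * (alpha1 * A);
  enc2_avg : forall m, \sum_(t < n) nth 0 (enc2 m : seq R) t <= n%:R * (alpha2 * A);
  dec1_meas : forall m, measurable (dec1 @^-1` [set m]);
  dec2_meas : forall m, measurable (dec2 @^-1` [set m])
}.

Section errors.
Variables (h11 h12 h21 h22 sigma A alpha1 alpha2 : R) (n M1 M2 : nat).
Variable c : code A alpha1 alpha2 n M1 M2.

Definition Pe1 : R :=
  (\sum_(m1 < M1) \sum_(m2 < M2)
     gprob sigma
       (fun t => h11 * nth 0 (enc1 c m1 : seq R) t + h21 * nth 0 (enc2 c m2 : seq R) t)
       [set y | dec1 c y != m1]) / (M1 * M2)%:R.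

Definition Pe2 : R :=
  (\sum_(m1 < M1) \sum_(m2 < M2)
     gprob sigma
       (fun t => h22 * nth 0 (enc2 c m2 : seq R) t + h12 * nth 0 (enc1 c m1 : seq R) t)
       [set y | dec2 c y != m2]) / (M1 * M2)%:R.
End errors.

Definition achievable (h11 h12 h21 h22 sigma A alpha1 alpha2 R1 R2 : R) : Prop :=
  exists cs : forall n : nat, code A alpha1 alpha2 n (nmsg n R1) (nmsg n R2),
    (fun n => Pe1 h11 h21 sigma (cs n)) @ \oo --> (0 : R) /\
    (fun n => Pe2 h12 h22 sigma (cs n)) @ \oo --> (0 : R).

Definition capacity_region (h11 h12 h21 h22 sigma A alpha1 alpha2 : R) : set (R * R) :=
  closure [set p | achievable h11 h12 h21 h22 sigma A alpha1 alpha2 p.1 p.2].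

Definition in_G (h11 h12 h21 h22 sigma A alpha1 alpha2 : R) (p : R * R) : Prop :=
  capacity_region h11 h12 h21 h22 sigma A alpha1 alpha2 p \/
  ((p.1 < 0 \/ p.2 < 0) /\
   exists q, capacity_region h11 h12 h21 h22 sigma A alpha1 alpha2 q /\
             p.1 <= q.1 /\ p.2 <= q.2).

Definition corr (sigma A alpha hji hjj : R) : R :=
  Num.min 0 ((1/2) * log2 (Num.max (hji ^+ 2 / hjj ^+ 2)
     ((1 - hji ^+ 2 / hjj ^+ 2) / 2 `^ (2 * Cbar sigma (hjj * A) alpha)))).

Definition GZ' (h11 h12 h21 h22 sigma A alpha R1 R2 : R) : Prop :=
  [/\ 0 <= R1 /\ 0 <= R2,
      R1 <= Cbar sigma (h11 * A) alpha,
      R2 <= Cbar sigma (h22 * A) alpha,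
      R1 + R2 <= Cbar sigma ((h11 + h21) * A) alpha - corr sigma A alpha h21 h22
    & R1 + R2 <= Cbar sigma ((h22 + h12) * A) alpha - corr sigma A alpha h12 h11].

End IMDD.

(* Main.v *)
Require Import Defs.
From HB Require Import structures.
From mathcomp Require Import all_boot all_order all_algebra.
From mathcomp Require Import all_classical all_reals all_analysis.
From mathcomp Require Import measurable_realfun normal_distribution.
From mathcomp Require Import ring lra.

(** Under strong interference the correction term vanishes, and
  [Cbar sigma A alpha = log2 (L * A / sigma) + o(1)] with
  [L = exp (h alpha) / sqrt (2 pi e)], [h alpha] being the largest differential
  entropy of a law on [0, 1] of mean at most [alpha].  The upper bound follows
  by choosing [xi = rho * sigma] in the objectives, and for [alpha < 1/2] the
  parameter [mu] of the truncated exponential law of mean [alpha].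

  Conversely, codewords are drawn uniformly from the words of a fine grid that
  are typical for the (discretized) maximum entropy law.  A receiver looks for
  a pair of codewords leaving a residual of squared length at most
  [n * sigma^2 * (1 + e)].  A Chernoff bound and a Riemann sum of the Gaussian
  density show that a received word is compatible with about
  [(sqrt (2 pi e) * sigma / (h * step))^n] grid words of gain [h].
  A wrong pair is controlled by the stronger of its two gains, so that the sum
  rate at receiver 1 may approach
  [log2 (L * max h11 h21 * A / sigma)], which is at most one bit below
  [log2 (L * (h11 + h21) * A / sigma)]. *)

(** Drawing codewords uniformly from a typical set, rather than symbol by symbol, makes both input
    constraints hold for every codeword, and a confusion probability becomes a ratio of two counts:
    words compatible with the received one, over words available. The numerator is bounded uniformly
    in the received word and in the other user's codeword, which enters only as a fixed shift. No
    entropy of a sum of two inputs is ever computed; the price is that only one of the two gains is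
    exploited at a time, hence the maximum of the gains in place of their sum. For a fixed [A / s]
    every nonnegative rate pair strictly below the resulting bounds is achieved, the grid being
    fixed before the block length grows. A large [A / s] serves to compare these bounds with [Cbar]
    and to make them positive. *)

Set Implicit Arguments.
Unset Strict Implicit.
Unset Printing Implicit Defensive.
Import Order.TTheory GRing.Theory Num.Theory.
Import numFieldNormedType.Exports.
Local Open Scope classical_set_scope.
Local Open Scope ring_scope.

(** * Densities and exponential moments of the normal law *)

Section gaussian.
Context {R : realType}.
Implicit Types m s u : R.

(** The Radon-Nikodym derivative and [normal_pdf] have the same integral over every measurable set,
    hence agree almost everywhere. *)
Lemma ge0_integral_normal_prob m s (f : R -> \bar R) :
  (forall x, 0 <= f x)%E -> measurable_fun [set: R] f ->
  (\int[normal_prob m s]_x f x =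
   \int[lebesgue_measure]_x (f x * (normal_pdf m s x)%:E))%E.
Proof.
move=> f0 mf.
have dom := @normal_prob_dominates R m s.
rewrite -(Radon_Nikodym_SigmaFinite.change_of_variables dom f0 measurableT mf).
apply: ae_eq_integral => //.
- apply: emeasurable_funM => //; apply: measurable_int.
  exact: Radon_Nikodym_SigmaFinite.f_integrable dom.
- apply: emeasurable_funM => //.
  by apply/measurable_EFinP; exact: measurable_normal_pdf.
apply: ae_eqe_mul2l; apply: integral_ae_eq => //.
- exact: Radon_Nikodym_SigmaFinite.f_integrable dom.
- by apply/measurable_EFinP; exact: measurable_normal_pdf.
- by move=> A _ mA; rewrite -(Radon_Nikodym_SigmaFinite.f_integral dom).
Qed.

Lemma normal_peakZ s u : 0 < s -> 0 < u ->
  normal_peak s = u * normal_peak (s * u).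
Proof.
move=> s0 u0; rewrite /normal_peak.
have -> : (s * u) ^+ 2 * pi *+ 2 = u ^+ 2 * (s ^+ 2 * pi *+ 2) by ring.
rewrite sqrtrM ?sqr_ge0// sqrtr_sqr ger0_norm ?ltW//.
by rewrite invfM mulVKf ?gt_eqF.
Qed.

(** For [c = sqrt (1 - 2 u)], the integrand times the normal density is [c^-1] times the normal
    density of standard deviation [s / c]. *)
Lemma normal_prob_expR_sqr m s u : 0 < s -> 2 * u < 1 ->
  (\int[normal_prob m s]_x (expR (u * ((x - m) / s) ^+ 2))%:E =
   ((Num.sqrt (1 - 2 * u))^-1)%:E)%E.
Proof.
move=> s0 u1.
have c0 : 0 < Num.sqrt (1 - 2 * u) by rewrite sqrtr_gt0 subr_gt0.
set c := Num.sqrt _ in c0 *.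
have c2 : c ^+ 2 = 1 - 2 * u by rewrite sqr_sqrtr// subr_ge0 ltW.
have sc0 : 0 < s * c^-1 by rewrite mulr_gt0 ?invr_gt0.
rewrite ge0_integral_normal_prob//; last first.
    apply/measurable_EFinP/measurableT_comp => //; apply: measurable_funM => //.
    by apply: measurable_funX; apply: measurable_funM => //; exact: measurable_funB.
transitivity (\int[lebesgue_measure]_x (c^-1%:E * (normal_pdf m (s * c^-1) x)%:E))%E;
    last first.
  rewrite ge0_integralZl//.
  - by rewrite integral_normal_pdf mule1.
  - by apply/measurable_EFinP; exact: measurable_normal_pdf.
  - by move=> x _; rewrite lee_fin normal_pdf_ge0.
  - by rewrite lee_fin invr_ge0 ltW.
apply: eq_integral => x _; rewrite -!EFinM; congr EFin.
rewrite !normal_pdfE ?gt_eqF// (normal_peakZ s0 (_ : 0 < c^-1)) ?invr_gt0//.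
rewrite mulrCA -!mulrA; congr (_ * (_ * _)); rewrite /normal_fun -expRD.
congr expR; rewrite !exprMn !exprVn c2.
field; rewrite ?gt_eqF//=; lra.
Qed.

End gaussian.

(** * Iterated Gaussian expectations *)

Section gexp_theory.
Context {R : realType}.
Variable s : R.

Lemma gexp_ge0 n mu (f : n.-tuple R -> \bar R) :
  (forall y, 0 <= f y)%E -> (0 <= gexp s mu f)%E.
Proof.
elim: n mu f => [|n IH] mu f f0 /=; first exact: f0.
by apply: integral_ge0 => z _; exact: IH.
Qed.

(** The parameter space [T] makes the induction go through: the coordinate being integrated joins
    the parameters, and Tonelli gives measurability in what remains. *)
Lemma measurable_gexp d (T : measurableType d) n mu
    (f : T * n.-tuple R -> \bar R) :
  measurable_fun [set: _] f -> (forall y, 0 <= f y)%E ->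
  measurable_fun setT (fun t => gexp s mu (fun y => f (t, y))).
Proof.
elim: n d T mu f => [|n IH] d T mu f mf f0 /=.
  exact: (measurableT_comp mf).
pose g (p : (T * R) * n.-tuple R) := f (p.1.1, cons_tuple p.1.2 p.2).
have mg : measurable_fun setT g.
  apply: (measurableT_comp mf); apply/measurable_fun_pairP; split => /=.
    exact: (measurableT_comp measurable_fst measurable_fst).
  by apply: measurable_cons => //; exact: (measurableT_comp measurable_snd measurable_fst).
have g0 p : (0 <= g p)%E by exact: f0.
have mG := IH _ _ (fun t => mu t.+1) g mg g0.
have G0 x : (0 <= gexp s (fun t => mu t.+1) (fun y => g (x, y)))%E.
  exact: gexp_ge0.
have := @measurable_fun_fubini_tonelli_F _ _ T _ R (normal_prob (mu 0%N) s) _ mG G0.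
by [].
Qed.

Lemma measurable_gexp_cons n mu (f : n.+1.-tuple R -> \bar R) :
  measurable_fun [set: _] f -> (forall y, 0 <= f y)%E ->
  measurable_fun setT (fun z : R => gexp s mu (fun y => f (cons_tuple z y))).
Proof.
move=> mf f0.
apply: (@measurable_gexp _ _ n mu (fun p : R * n.-tuple R => f (cons_tuple p.1 p.2))).
  by apply: (measurableT_comp mf); apply: measurable_cons.
by move=> ?; exact: f0.
Qed.

Lemma measurable_cons_section n (f : n.+1.-tuple R -> \bar R) z :
  measurable_fun [set: _] f -> measurable_fun setT (fun y => f (cons_tuple z y)).
Proof. by move=> mf; apply: (measurableT_comp mf); exact: measurable_cons. Qed.

Lemma le_gexp n mu (f g : n.-tuple R -> \bar R) :
  measurable_fun [set: _] f -> measurable_fun setT g ->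
  (forall y, 0 <= f y)%E -> (forall y, f y <= g y)%E ->
  (gexp s mu f <= gexp s mu g)%E.
Proof.
elim: n mu f g => [|n IH] mu f g mf mg f0 fg /=; first exact: fg.
have g0 y : (0 <= g y)%E by exact: le_trans (f0 y) (fg y).
apply: ge0_le_integral => //=.
- by move=> z _; exact: gexp_ge0.
- exact: measurable_gexp_cons.
- exact: measurable_gexp_cons.
- by move=> z _; apply: IH => //; exact: measurable_cons_section.
Qed.

Lemma gexpD n mu (f g : n.-tuple R -> \bar R) :
  measurable_fun [set: _] f -> measurable_fun setT g ->
  (forall y, 0 <= f y)%E -> (forall y, 0 <= g y)%E ->
  (gexp s mu (fun y => f y + g y) = gexp s mu f + gexp s mu g)%E.
Proof.
elim: n mu f g => [//|n IH] mu f g mf mg f0 g0 /=.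
rewrite -ge0_integralD//.
- by apply: eq_integral => z _; rewrite IH//; exact: measurable_cons_section.
- by move=> z _; exact: gexp_ge0.
- exact: measurable_gexp_cons.
- by move=> z _; exact: gexp_ge0.
- exact: measurable_gexp_cons.
Qed.

Lemma gexp_cst n mu (a : \bar R) : gexp s mu (fun _ : n.-tuple R => a) = a.
Proof.
elim: n mu => //= n IH mu; under eq_integral do rewrite IH.
rewrite (integral_cst _ measurableT) -[RHS]mule1; congr (_ * _)%E.
exact: (@probability_setT _ _ R (normal_prob (mu 0%N) s)).
Qed.

Lemma gexp_sum I (r : seq I) n mu (f : I -> n.-tuple R -> \bar R) :
  (forall i, measurable_fun setT (f i)) -> (forall i y, 0 <= f i y)%E ->
  (gexp s mu (fun y => \sum_(i <- r) f i y) = \sum_(i <- r) gexp s mu (f i))%E.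
Proof.
move=> mf f0; elim: r => [|i r IH].
  by rewrite big_nil -[RHS](@gexp_cst n mu); congr gexp; apply/funext => y; rewrite big_nil.
rewrite big_cons -IH -gexpD//.
- by congr gexp; apply/funext => y; rewrite big_cons.
- exact: emeasurable_sum.
- by move=> y; apply: sume_ge0 => j _.
Qed.

(** The prefactor [a] lets the induction absorb the factor [phi (z - mu 0)] of the coordinate
    already fixed. *)
Lemma gexp_prod_le n mu (phi : R -> R) (a c : R) :
  measurable_fun setT phi -> (forall x, 0 <= phi x) -> 0 <= a ->
  (forall m, \int[normal_prob m s]_x (phi (x - m))%:E <= c%:E)%E ->
  (gexp s mu (fun y : n.-tuple R => (a * \prod_(t < n) phi (tnth y t - mu t))%:E)
   <= (a * c ^+ n)%:E)%E.
Proof.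
move=> mphi phi0 + phic.
have mphi' m : measurable_fun setT (fun x : R => phi (x - m)).
  by apply: measurableT_comp => //; exact: measurable_funB.
have c0 : 0 <= c.
  by rewrite -lee_fin; apply: le_trans (phic 0); apply: integral_ge0 => x _; rewrite lee_fin.
have mprod k nu (b : R) : measurable_fun setT
    (fun y : k.-tuple R => (b * \prod_(t < k) phi (tnth y t - nu t))%:E).
  apply/measurable_EFinP/measurable_funM => //; apply: measurable_prod => t _.
  by apply: (measurableT_comp (mphi' _)); exact: measurable_tnth.
elim: n mu a => [|n IH] mu a a0; first by rewrite /= big_ord0.
have key z : (fun y : n.-tuple R =>
    (a * \prod_(t < n.+1) phi (tnth (cons_tuple z y) t - mu t))%:E) =
    (fun y => ((a * phi (z - mu 0%N)) * \prod_(t < n) phi (tnth y t - mu t.+1))%:E).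
  apply/funext => y; rewrite big_ord_recl mulrA; congr (_ * _)%:E.
  by apply: eq_bigr => t _; rewrite tnthS.
rewrite /=.
apply: (@le_trans _ _ (\int[normal_prob (mu 0%N) s]_z
    ((a * c ^+ n)%:E * (phi (z - mu 0%N))%:E))%E).
  apply: ge0_le_integral => //.
  - move=> z _; apply: gexp_ge0 => y.
    by rewrite lee_fin mulr_ge0// prodr_ge0.
  - apply: (@measurable_gexp_cons n (fun t => mu t.+1)
      (fun y => (a * \prod_(t < n.+1) phi (tnth y t - mu t))%:E)) => //.
    by move=> y; rewrite lee_fin mulr_ge0// prodr_ge0.
  - by apply: measurable_funeM; apply/measurable_EFinP; exact: mphi'.
  - move=> z _; rewrite key (le_trans (IH _ _ _)) ?mulr_ge0//.
    by rewrite -EFinM lee_fin mulrAC.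
rewrite ge0_integralZl//.
- rewrite exprSr mulrA [leRHS]EFinM; apply: lee_wpmul2l; last exact: phic.
  by rewrite lee_fin mulr_ge0// exprn_ge0.
- by apply/measurable_EFinP; exact: mphi'.
- by move=> x _; rewrite lee_fin.
- by rewrite lee_fin mulr_ge0// exprn_ge0.
Qed.

End gexp_theory.

(** * Union bounds and typicality of the noise *)

Section gprob_theory.
Context {R : realType}.
Variable s : R.

Lemma gprobE n mu (S : set (n.-tuple R)) : measurable S ->
  ((gprob s mu S)%:E = gexp s mu (fun y => (\1_S y)%:E))%E.
Proof.
move=> mS; rewrite /gprob fineK// ge0_fin_numE; last first.
  by apply: gexp_ge0 => y; rewrite lee_fin.
have mI : measurable_fun setT (fun y : n.-tuple R => (\1_S y : R)%:E).
  by apply/measurable_EFinP; exact: measurable_indic.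
apply: (@le_lt_trans _ _ (gexp s mu (fun _ : n.-tuple R => 1%:E))); last first.
  by rewrite gexp_cst ltry.
apply: le_gexp => // y; rewrite lee_fin// indicE; by case: (y \in S).
Qed.

Lemma gprob_sum_le (I : Type) (r : seq I) n mu (S : set (n.-tuple R))
    (T : I -> set (n.-tuple R)) :
  measurable S -> (forall i, measurable (T i)) ->
  (forall y, S y -> exists2 i, List.In i r & T i y) ->
  gprob s mu S <= \sum_(i <- r) gprob s mu (T i).
Proof.
move=> mS mT ST; rewrite -lee_fin -sumEFin gprobE//.
under eq_bigr do rewrite gprobE//.
have mI (A : set (n.-tuple R)) : measurable A ->
    measurable_fun setT (fun y : n.-tuple R => (\1_A y : R)%:E).
  by move=> mA; apply/measurable_EFinP; exact: measurable_indic.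
rewrite -gexp_sum; [|by move=> i; exact: mI|by move=> i y; rewrite lee_fin].
apply: le_gexp.
- exact: mI.
- by apply: emeasurable_sum => i; exact: mI.
- by move=> y; rewrite lee_fin.
move=> y; rewrite sumEFin lee_fin {1}indicE.
case: (boolP (y \in S)) => [|_]; last by apply: sumr_ge0 => i _; rewrite indicE.
rewrite inE => /ST[i ir Tiy].
elim: r ir {ST} => //= j r IH [->|ir].
  by rewrite big_cons indicE mem_set//= lerDl; apply: sumr_ge0 => k _; rewrite indicE.
by rewrite big_cons (le_trans (IH ir))// lerDr indicE.
Qed.

(** The bridge from counting to probability: the sum of the indicators is bounded pointwise, so its
    mean is too, whatever the law. *)
Lemma sum_gprob_le (I : finType) n mu (T : I -> set (n.-tuple R)) (B : R) :
  (forall i, measurable (T i)) ->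
  (forall y, \sum_i \1_(T i) y <= B) ->
  \sum_i gprob s mu (T i) <= B.
Proof.
move=> mT TB; rewrite -lee_fin -sumEFin.
under eq_bigr do rewrite gprobE//.
have mI i : measurable_fun setT (fun y : n.-tuple R => (\1_(T i) y : R)%:E).
  by apply/measurable_EFinP; exact: measurable_indic.
rewrite -gexp_sum//.
rewrite -[leRHS](@gexp_cst _ s n mu); apply: le_gexp => //.
- exact: emeasurable_sum.
- by move=> y; rewrite sume_ge0// => i _; rewrite lee_fin.
- by move=> y; rewrite sumEFin lee_fin.
Qed.

Definition typical n (d : R) (mu : nat -> R) (y : n.-tuple R) : bool :=
  \sum_(t < n) ((tnth y t - mu t) / s) ^+ 2 <= n%:R * (1 + d).

Lemma measurable_typical n d mu : measurable [set y | @typical n d mu y].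
Proof.
rewrite -[X in measurable X]setTI; apply: measurable_fun_le => //.
apply: measurable_sum => t; apply: measurable_funX; apply: measurable_funM => //.
by apply: measurable_funB => //; exact: measurable_tnth.
Qed.

(** Chernoff bound: Markov's inequality for the exponential of [u] times the sum of squared
    normalized residuals, whose mean factorizes over the coordinates. *)
Lemma atypical_gprob_le n d mu u : 0 < s -> 0 <= u -> 2 * u < 1 ->
  gprob s mu [set y | ~~ @typical n d mu y] <=
  ((Num.sqrt (1 - 2 * u))^-1 * expR (- (u * (1 + d)))) ^+ n.
Proof.
move=> s0 u0 u1.
have mS : measurable [set y | ~~ @typical n d mu y].
  have -> : [set y | ~~ @typical n d mu y] = ~` [set y | @typical n d mu y].
    by apply/seteqP; split => y /= /negP.
  by apply: measurableC; exact: measurable_typical.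
pose phi (x : R) := expR (u * (x / s) ^+ 2).
have mphi : measurable_fun setT phi.
  apply: measurableT_comp => //; apply: measurable_funM => //.
  by apply: measurable_funX; exact: measurable_funM.
rewrite -lee_fin gprobE// exprMn mulrC.
apply: le_trans (@gexp_prod_le _ s n mu phi _ _ mphi _ _ _); last 3 first.
- by move=> x; exact: expR_ge0.
- by rewrite exprn_ge0// expR_ge0.
- by move=> m; rewrite /phi normal_prob_expR_sqr.
apply: le_gexp.
- by apply/measurable_EFinP; exact: measurable_indic.
- apply/measurable_EFinP/measurable_funM => //; apply: measurable_prod => t _.
  apply: (measurableT_comp mphi); apply: measurable_funB => //.
  exact: measurable_tnth.
- by move=> y; rewrite lee_fin.
move=> y; rewrite lee_fin indicE; case: (boolP (y \in _)) => [|_] /=; last first.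
  by rewrite mulr_ge0 ?exprn_ge0 ?prodr_ge0 ?expR_ge0// => t _; exact: expR_ge0.
rewrite inE /= /typical -ltNge => ny.
rewrite -expRM_natl -expR_sum -expRD -[leLHS]expR0 ler_expR -mulr_sumr.
rewrite mulrN addrC subr_ge0 mulrCA ler_wpM2l//; exact: ltW.
Qed.

End gprob_theory.

(** Used for the decoders, whose output depends on [y] only through finitely many typicality
    tests. *)
Lemma measurable_finite_pattern d (T : measurableType d) (I : finType)
    (P : I -> pred T) (E : set {ffun I -> bool}) :
  (forall i, measurable [set y | P i y]) ->
  measurable [set y | E [ffun i => P i y]].
Proof.
move=> mP.
have -> : [set y | E [ffun i => P i y]] =
    \bigcup_(f in E) \bigcap_(i in [set: I]) [set y | P i y = f i].
  apply/seteqP; split => [y /= Ey|y /= [f Ef fy]].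
    by exists [ffun i => P i y] => // i _ /=; rewrite ffunE.
  suff -> : [ffun i => P i y] = f by [].
  by apply/ffunP => i; rewrite ffunE; exact: fy.
apply: fin_bigcup_measurable => [|f _]; first exact: finite_finset.
apply: fin_bigcap_measurable => [|i _]; first exact: finite_finset.
case: (f i); first exact: mP.
have -> : [set y | P i y = false] = ~` [set y | P i y].
  by apply/seteqP; split => y /= /negP; case: (P i y).
exact: measurableC.
Qed.

(** * Averages over codebooks *)

Section averaging.
Context {R : realType}.

Definition upd (I X : finType) (c : {ffun I -> X}) (i : I) (x : X) :
  {ffun I -> X} := [ffun j => if j == i then x else c j].

Lemma upd_neq (I X : finType) (c : {ffun I -> X}) i x j :
  j != i -> upd c i x j = c j.
Proof. by move=> /negPf ji; rewrite ffunE ji. Qed.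

Lemma upd_eq (I X : finType) (c : {ffun I -> X}) i x : upd c i x i = x.
Proof. by rewrite ffunE eqxx. Qed.

(** Exchanging the new codeword [x] with the old one [c i] is an involution of the pairs [(c, x)]:
    redrawing one entry of a uniform codebook leaves it uniform. *)
Lemma sum_upd (I X : finType) (i : I) (F : {ffun I -> X} -> R) :
  \sum_c \sum_x F (upd c i x) = (\sum_c F c) * #|X|%:R.
Proof.
pose swap (p : {ffun I -> X} * X) := (upd p.1 i p.2, p.1 i).
have swapK : involutive swap.
  move=> [c x]; rewrite /swap /= upd_eq; congr (_, _).
  by apply/ffunP => j; rewrite !ffunE; case: eqVneq => // ->.
rewrite pair_bigA /= (reindex_inj (inv_inj swapK)) /=.
transitivity (\sum_(p : {ffun I -> X} * X) F p.1).
  by apply: eq_bigr => -[c x] _ /=; have := swapK (c, x) => -[-> _].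
rewrite -(pair_bigA _ (fun c _ => F c)) /= mulr_suml.
by apply: eq_bigr => c _; rewrite sumr_const mulr_natr.
Qed.

Lemma average_upd (I X : finType) (i : I) (F : {ffun I -> X} -> R) (B : R) :
  (0 < #|X|)%N -> (forall c, \sum_x F (upd c i x) <= B) ->
  \sum_c F c <= #|{ffun I -> X}|%:R * (B / #|X|%:R).
Proof.
move=> X0 FB; rewrite mulrA ler_pdivlMr ?ltr0n// -(sum_upd i).
apply: (@le_trans _ _ (\sum_(c : {ffun I -> X}) B)); first exact: ler_sum.
by rewrite sumr_const mulr_natl.
Qed.

Lemma ex_le_average (I : finType) (F : I -> R) (B : R) :
  (0 < #|I|)%N -> \sum_i F i <= #|I|%:R * B -> exists i, F i <= B.
Proof.
move=> /card_gt0P[i0 _] FB; apply: contrapT => nF.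
have : \sum_(i : I) B < \sum_i F i.
  apply: ltr_sum => [|i _]; first by apply/hasP; exists i0; rewrite ?mem_index_enum.
  by rewrite ltNge; apply/negP => FiB; apply: nF; exists i.
by rewrite sumr_const -mulr_natl ltNge FB.
Qed.

End averaging.

(** * Random coding with joint typicality decoding *)

Section random_coding.
Context {R : realType}.
Variables (s : R) (n : nat) (d : R) (X : finType) (w : X -> n.-tuple R).
Hypothesis X0 : (0 < #|X|)%N.

(* Both receivers are treated at once: [g] is the gain of the wanted codeword
   [x] and [k] the gain of the interfering codeword [x']. *)
Definition mean (g k : R) (x x' : X) : nat -> R :=
  fun t => g * nth 0 (w x : seq R) t + k * nth 0 (w x' : seq R) t.

(* The interfering message need not be decoded uniquely. *)
Definition decoder (g k : R) M N (m0 : 'I_M) (c : {ffun 'I_M -> X})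
    (e : {ffun 'I_N -> X}) (y : n.-tuple R) : 'I_M :=
  odflt m0 [pick m | [exists m', typical s d (mean g k (c m) (e m')) y]].

Lemma measurable_decoder g k M N (m0 : 'I_M) c (e : {ffun 'I_N -> X})
    (E : set 'I_M) : measurable [set y | E (decoder g k m0 c e y)].
Proof.
pose P (p : 'I_M * 'I_N) (y : n.-tuple R) := typical s d (mean g k (c p.1) (e p.2)) y.
pose G (f : {ffun 'I_M * 'I_N -> bool}) :=
  odflt m0 [pick m | [exists m', f (m, m')]].
have -> : [set y | E (decoder g k m0 c e y)] =
          [set y | (E \o G) [ffun p => P p y]].
  suff dE y : decoder g k m0 c e y = G [ffun p => P p y].
    by apply/seteqP; split => y /=; rewrite dE.
  rewrite /decoder /G; congr odflt; apply: eq_pick => m.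
  by apply: eq_existsb => m'; rewrite ffunE.
by apply: measurable_finite_pattern => p; exact: measurable_typical.
Qed.

Variables (p0 : R).
Hypothesis atypical_le :
  forall mu, gprob s mu [set y : n.-tuple R | ~~ typical s d mu y] <= p0.
Variable (B : R -> R).
Hypothesis B_ge : forall h (v : nat -> R) (y : n.-tuple R), 0 < h ->
  \sum_x (typical s d (fun t => h * nth 0 (w x : seq R) t + v t) y)%:R <= B h.

Definition err g k M N (m0 : 'I_M) (c : {ffun 'I_M -> X})
    (e : {ffun 'I_N -> X}) (m : 'I_M) (m' : 'I_N) : R :=
  gprob s (mean g k (c m) (e m')) [set y | decoder g k m0 c e y != m].

Definition confusion g k M N (c : {ffun 'I_M -> X}) (e : {ffun 'I_N -> X})
    (m : 'I_M) (m' : 'I_N) (a : 'I_M) (b : 'I_N) : R :=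
  gprob s (mean g k (c m) (e m')) [set y : n.-tuple R | typical s d (mean g k (c a) (e b)) y].

Lemma gprob_setU2_le mu (S A C : set (n.-tuple R)) :
  measurable S -> measurable A -> measurable C -> S `<=` A `|` C ->
  gprob s mu S <= gprob s mu A + gprob s mu C.
Proof.
move=> mS mA mC SAC.
have := @gprob_sum_le R s bool [:: true; false] n mu S (fun b => if b then A else C) mS.
rewrite big_cons big_seq1; apply; first by case.
by move=> y /SAC[?|?]; [exists true|exists false] => //=; tauto.
Qed.

(** If the true pair is typical, the decoder does find some message, so an error forces a typical
    pair with [a != m]. A pair with the right [m] and a wrong [m'] does no harm and contributes no
    term. *)
Lemma err_le g k M N (m0 : 'I_M) c (e : {ffun 'I_N -> X}) m m' :
  err g k m0 c e m m' <=
  p0 + \sum_(a < M | a != m) \sum_(b < N) confusion g k c e m m' a b.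
Proof.
rewrite /err; set mu := mean g k (c m) (e m').
pose T (p : 'I_M * 'I_N) := [set y : n.-tuple R | typical s d (mean g k (c p.1) (e p.2)) y].
pose r := [seq p <- index_enum ('I_M * 'I_N)%type | p.1 != m].
have mT p : measurable (T p) by exact: measurable_typical.
have mA : measurable [set y : n.-tuple R | ~~ typical s d mu y].
  have -> : [set y : n.-tuple R | ~~ typical s d mu y] = ~` [set y | typical s d mu y].
    by apply/seteqP; split => y /= /negP.
  by apply: measurableC; exact: measurable_typical.
have mU : measurable (\bigcup_(p in [set p | p.1 != m]) T p).
  by apply: fin_bigcup_measurable; first exact: finite_finset.
apply: (le_trans (@gprob_setU2_le mu _ _ _ _ mA mU _)).
- exact: (measurable_decoder g k m0 c e [set a | a != m]).
- move=> y /=; have [ty|] := boolP (typical s d mu y); last by left.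
  rewrite /decoder; case: pickP => [a /existsP[b tab] /= am|none _].
    by right; exists (a, b).
  by have /existsP[] := none m; exists m'.
apply: lerD; first exact: atypical_le.
have -> : \sum_(a < M | a != m) \sum_(b < N) confusion g k c e m m' a b =
    \sum_(p <- r) gprob s mu (T p).
  rewrite /r big_filter pair_big /=.
  by apply: eq_big => [[a b]|[a b] _] //=; rewrite andbT.
apply: gprob_sum_le => // y [p pm Ty]; exists p => //.
have : p \in r by rewrite mem_filter pm mem_index_enum.
elim: (r) => //= q r' IH; rewrite inE => /orP[/eqP->|/IH]; by [left|right].
Qed.

(** Since [a != m], redrawing the codeword of [a] does not change the law of the output. For each
    output at most [B g] replacements are typical, the interfering codeword acting as the shift
    [v]. *)
Lemma confusion_own_le g k M N (e : {ffun 'I_N -> X}) (m : 'I_M) m' a b :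
  0 < g -> a != m ->
  \sum_c confusion g k c e m m' a b <= #|{ffun 'I_M -> X}|%:R * (B g / #|X|%:R).
Proof.
move=> g0 am; apply: (average_upd (i := a)) => // c.
rewrite /confusion; under eq_bigr do rewrite upd_eq upd_neq 1?eq_sym//.
apply: sum_gprob_le => [x|y]; first exact: measurable_typical.
apply: le_trans (B_ge (fun t => k * nth 0 (w (e b) : seq R) t) y g0).
by apply: ler_sum => x _; rewrite indicE mem_setE.
Qed.

Lemma confusion_other_le g k M N (c : {ffun 'I_M -> X}) (m : 'I_M) (m' : 'I_N) a b :
  0 < k -> b != m' ->
  \sum_e confusion g k c e m m' a b <= #|{ffun 'I_N -> X}|%:R * (B k / #|X|%:R).
Proof.
move=> k0 bm; apply: (average_upd (i := b)) => // e.
rewrite /confusion; under eq_bigr do rewrite upd_eq upd_neq 1?eq_sym//.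
apply: sum_gprob_le => [x|y]; first exact: measurable_typical.
apply: le_trans (B_ge (fun t => g * nth 0 (w (c a) : seq R) t) y k0).
apply: ler_sum => x _; rewrite indicE mem_setE.
suff -> : mean g k (c a) x = (fun t => k * nth 0 (w x : seq R) t +
    g * nth 0 (w (c a) : seq R) t) by [].
by apply/funext => t; rewrite /mean addrC.
Qed.

(** With [b = m'] the interfering codeword is the one transmitted, and only the wanted one can be
    redrawn: at most [M] pairs at cost [B g]. With [b != m'] either can be redrawn, so that [Bx] may
    be taken from the more favourable gain. *)
Lemma sum_err_le g k M N (m0 : 'I_M) (m : 'I_M) (m' : 'I_N) (Bx : R) :
  0 < g -> 0 < k -> 0 <= B g -> 0 <= Bx -> Bx = B g \/ Bx = B k ->
  \sum_c \sum_e err g k m0 c e m m' <=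
  (#|{ffun 'I_M -> X}| * #|{ffun 'I_N -> X}|)%:R *
  (p0 + M%:R * (B g / #|X|%:R) + (M * N)%:R * (Bx / #|X|%:R)).
Proof.
move=> g0 k0 Bg0 Bx0 BxE.
set CM := #|{ffun 'I_M -> X}|; set CN := #|{ffun 'I_N -> X}|.
have conf a b : a != m -> \sum_c \sum_e confusion g k c e m m' a b <=
    (CM * CN)%:R * ((if b == m' then B g else Bx) / #|X|%:R).
  move=> am.
  have own : \sum_c \sum_e confusion g k c e m m' a b <= (CM * CN)%:R * (B g / #|X|%:R).
    rewrite exchange_big/= natrM (mulrC CM%:R) -mulrA -/CN.
    apply: (@le_trans _ _ (\sum_(e : {ffun 'I_N -> X}) (CM%:R * (B g / #|X|%:R)))).
      by apply: ler_sum => e _; exact: confusion_own_le.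
    by rewrite sumr_const -[leLHS]mulr_natl.
  have [//|bm] := eqVneq b m'.
  case: BxE => -> //.
  apply: (@le_trans _ _ (\sum_(c : {ffun 'I_M -> X}) (CN%:R * (B k / #|X|%:R)))).
    by apply: ler_sum => c _; exact: confusion_other_le.
  by rewrite sumr_const -[leLHS]mulr_natl natrM mulrA.
apply: (@le_trans _ _ (\sum_c \sum_e (p0 + \sum_(a < M | a != m) \sum_(b < N)
    confusion g k c e m m' a b))).
  by apply: ler_sum => c _; apply: ler_sum => e _; exact: err_le.
have -> : \sum_(c : {ffun 'I_M -> X}) \sum_(e : {ffun 'I_N -> X})
     (p0 + \sum_(a < M | a != m) \sum_(b < N) confusion g k c e m m' a b) =
   (CM * CN)%:R * p0 + \sum_(a < M | a != m) \sum_(b < N)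
     \sum_c \sum_e confusion g k c e m m' a b.
  under eq_bigr do rewrite big_split/= sumr_const -/CN.
  rewrite big_split/= sumr_const -/CM -mulrnA mulnC mulr_natl; congr (_ + _).
  under eq_bigr => c _.
    rewrite exchange_big/=; under eq_bigr do rewrite exchange_big/=.
    over.
  rewrite exchange_big/=; apply: eq_bigr => a _.
  by rewrite exchange_big.
rewrite -addrA mulrDr lerD2l.
apply: (@le_trans _ _ (\sum_(a < M) \sum_(b < N) (CM * CN)%:R *
    ((if b == m' then B g else 0) / #|X|%:R + Bx / #|X|%:R))).
  rewrite big_mkcond/=; apply: ler_sum => a _; case: ifPn => am.
    apply: ler_sum => b _; apply: (le_trans (conf a b am)).
    rewrite ler_wpM2l// -mulrDl ler_wpM2r ?invr_ge0//.
    by case: ifPn => _; rewrite ?lerDl ?add0r.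
  apply: sumr_ge0 => b _; rewrite mulr_ge0// -mulrDl mulr_ge0 ?invr_ge0//.
  by rewrite addr_ge0//; case: ifP.
under eq_bigr do rewrite -mulr_sumr big_split/= -mulr_suml -big_mkcond big_pred1_eq
  sumr_const card_ord.
move: (_ %:R) (B g / _) (Bx / _) => K u v.
by rewrite sumr_const card_ord -[v *+ N]mulr_natl -mulr_natl natrM le_eqVlt;
  apply/orP; left; apply/eqP; ring.
Qed.

End random_coding.

(** * Existence of one code good for both receivers *)

Section random_codes.
Context {R : realType}.
Variables (h11 h12 h21 h22 s A alpha : R) (n : nat) (d : R).
Variables (X : finType) (w : X -> n.-tuple R).
Hypothesis X0 : (0 < #|X|)%N.
Hypothesis w_peak : forall x t, 0 <= nth 0 (w x : seq R) t <= A.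
Hypothesis w_avg : forall x,
  \sum_(t < n) nth 0 (w x : seq R) t <= n%:R * (alpha * A).
Variables (p0 : R) (B : R -> R).
Hypothesis atypical_le :
  forall mu, gprob s mu [set y : n.-tuple R | ~~ typical s d mu y] <= p0.
Hypothesis B_ge : forall h (v : nat -> R) (y : n.-tuple R), 0 < h ->
  \sum_x (typical s d (fun t => h * nth 0 (w x : seq R) t + v t) y)%:R <= B h.

Definition code_of M1 M2 (m1 : 'I_M1) (m2 : 'I_M2)
    (p : {ffun 'I_M1 -> X} * {ffun 'I_M2 -> X}) : Defs.code A alpha alpha n M1 M2 :=
  @Code R A alpha alpha n M1 M2 (fun m => w (p.1 m)) (fun m => w (p.2 m))
    (decoder s d w h11 h21 m1 p.1 p.2) (decoder s d w h22 h12 m2 p.2 p.1)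
    (fun m => w_peak (p.1 m)) (fun m => w_peak (p.2 m))
    (fun m => w_avg (p.1 m)) (fun m => w_avg (p.2 m))
    (fun m => measurable_decoder s d w h11 h21 m1 p.1 p.2 [set m])
    (fun m => measurable_decoder s d w h22 h12 m2 p.2 p.1 [set m]).

(** The two error probabilities are averaged as a sum, so a single pair of codebooks serves both
    receivers. *)
Lemma exists_code M1 M2 (B1 B2 : R) : (0 < M1)%N -> (0 < M2)%N ->
  0 < h11 -> 0 < h12 -> 0 < h21 -> 0 < h22 ->
  0 <= B h11 -> 0 <= B h22 -> 0 <= B1 -> 0 <= B2 ->
  B1 = B h11 \/ B1 = B h21 -> B2 = B h22 \/ B2 = B h12 ->
  exists c : Defs.code A alpha alpha n M1 M2,
    Pe1 h11 h21 s c + Pe2 h12 h22 s c <=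
    (p0 + M1%:R * (B h11 / #|X|%:R) + (M1 * M2)%:R * (B1 / #|X|%:R)) +
    (p0 + M2%:R * (B h22 / #|X|%:R) + (M1 * M2)%:R * (B2 / #|X|%:R)).
Proof.
move=> M10 M20 h110 h120 h210 h220 B11 B22 B10 B20 B1E B2E.
pose m1 := Ordinal M10; pose m2 := Ordinal M20.
set b1 := p0 + _ + _; set b2 := p0 + _ + _.
have M120 : (0 : R) < (M1 * M2)%:R by rewrite ltr0n muln_gt0 M10.
have E1 a b := @sum_err_le R s n d X w X0 p0 atypical_le B B_ge h11 h21 M1 M2 m1 a b B1
  h110 h210 B11 B10 B1E.
have E2 a b := @sum_err_le R s n d X w X0 p0 atypical_le B B_ge h22 h12 M2 M1 m2 b a B2
  h220 h120 B22 B20 B2E.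
pose C1 := {ffun 'I_M1 -> X}; pose C2 := {ffun 'I_M2 -> X}.
pose F1 (c1 : C1) (c2 : C2) := Pe1 h11 h21 s (code_of m1 m2 (c1, c2)).
pose F2 (c1 : C1) (c2 : C2) := Pe2 h12 h22 s (code_of m1 m2 (c1, c2)).
suff [[c1 c2] Fc] : exists p : C1 * C2, F1 p.1 p.2 + F2 p.1 p.2 <= b1 + b2.
  by exists (code_of m1 m2 (c1, c2)).
have C10 : (0 < #|C1|)%N by rewrite card_ffun expn_gt0 X0.
have C20 : (0 < #|C2|)%N by rewrite card_ffun expn_gt0 X0.
apply: ex_le_average; first by rewrite card_prod muln_gt0 C10.
rewrite card_prod -(pair_bigA _ (fun c1 c2 => F1 c1 c2 + F2 c1 c2)) /=.
under eq_bigr do rewrite big_split.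
rewrite big_split/= mulrDr.
have average (e : C1 -> C2 -> 'I_M1 -> 'I_M2 -> R) (b : R) :
    (forall a a', \sum_c1 \sum_c2 e c1 c2 a a' <= (#|C1| * #|C2|)%:R * b) ->
    \sum_c1 \sum_c2 (\sum_a \sum_a' e c1 c2 a a') / (M1 * M2)%:R <=
      (#|C1| * #|C2|)%:R * b.
  move=> eb.
  under eq_bigr do rewrite -mulr_suml.
  rewrite -mulr_suml ler_pdivrMr//.
  under eq_bigr => c1 _.
    rewrite exchange_big; under eq_bigr do rewrite exchange_big.
    over.
  rewrite exchange_big /=.
  apply: (@le_trans _ _ (\sum_(a < M1) \sum_(a' < M2) (#|C1| * #|C2|)%:R * b)).
    apply: ler_sum => a _; rewrite exchange_big; apply: ler_sum => a' _.
    exact: eb.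
  by rewrite !sumr_const !card_ord -mulrnA (mulnC M2) -[leLHS]mulr_natr.
apply: lerD.
  exact: (average (fun c1 c2 a a' => err s d w h11 h21 m1 c1 c2 a a') b1 E1).
apply: (average (fun c1 c2 a a' => err s d w h22 h12 m2 c2 c1 a' a) b2) => a a'.
by rewrite exchange_big (mulnC #|C1|); move: (E2 a a'); rewrite (mulnC M2).
Qed.

End random_codes.

(** * Riemann sums of a unimodal function, with an abstract tail integral [Phi] *)

Section unimodal_riemann.
Context {R : realType}.
Variables (g Phi : R -> R) (h : R).
Hypothesis h0 : 0 < h.
Hypothesis g01 : forall u, 0 <= g u <= 1.
Hypothesis g_even : forall u, g (- u) = g u.
Hypothesis g_mono : forall a b, 0 <= a -> a <= b -> g b <= g a.
Hypothesis Phi_ge0 : forall a, 0 <= Phi a.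
Hypothesis Phi_step : forall m a b, 0 <= m -> a <= b ->
  (forall u, a <= u < b -> m <= g u) -> m * (b - a) <= Phi a - Phi b.

Lemma shift_riemann N a : \sum_(k < N.+1) g (a + h * k%:R) =
  g a + \sum_(k < N) g (a + h + h * k%:R).
Proof.
rewrite big_ord_recl mulr0 addr0; congr (_ + _); apply: eq_bigr => k _.
by rewrite lift0 -natr1; congr g; ring.
Qed.

(** Beyond the mode, each term but the first is at most the integral over the preceding cell. *)
Lemma riemann_tail_le N a : 0 <= a ->
  h * \sum_(k < N) g (a + h * k%:R) <= h * g a + Phi a.
Proof.
elim: N a => [|N IH] a a0.
  by rewrite big_ord0 mulr0 addr_ge0// mulr_ge0 ?(ltW h0)//; case/andP: (g01 a).
have ah0 : 0 <= a + h by rewrite addr_ge0// ltW.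
have step : g (a + h) * (a + h - a) <= Phi a - Phi (a + h).
  apply: Phi_step; first by case/andP: (g01 (a + h)).
    by rewrite lerDl ltW.
  move=> u /andP[au uh]; apply: g_mono; last exact: ltW.
  exact: le_trans au.
by rewrite shift_riemann; have := IH _ ah0; nra.
Qed.

(** Left of the mode a term is compared with the integral over the following cell, right of it with
    the preceding one. The two endpoints of the cell straddling 0 are bounded by 1 each, which gives
    [2 * h]. *)
Lemma unimodal_riemann_le N a :
  h * \sum_(k < N) g (a + h * k%:R) <= 2 * h + Phi a.
Proof.
have hpos := h0; elim: N a => [|N IH] a.
  by rewrite big_ord0 mulr0 addr_ge0// mulr_ge0// ltW.
have /andP[ga0 ga1] := g01 a.
have [a0|a0] := leP 0 a.
  by apply: (le_trans (riemann_tail_le _ a0)); rewrite lerD2r; nra.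
rewrite shift_riemann.
have [ah|ah] := leP (a + h) 0.
  have step : g a * (a + h - a) <= Phi a - Phi (a + h).
    apply: Phi_step => //; first by rewrite lerDl ltW.
    move=> u /andP[au uh]; rewrite -(g_even a) -(g_even u); apply: g_mono.
      by rewrite oppr_ge0 (le_trans (ltW uh)).
    by rewrite lerN2.
  by have := IH (a + h); nra.
(* With [m = 0] the step hypothesis just says that [Phi] does not increase. *)
have step : 0 * (a + h - a) <= Phi a - Phi (a + h).
  by apply: Phi_step => // [|u _]; [lra|case/andP: (g01 u)].
have /andP[gah0 gah1] := g01 (a + h).
by have := @riemann_tail_le N _ (ltW ah); nra.
Qed.

End unimodal_riemann.

(** * Riemann sums of the Gaussian *)

Section gauss_riemann.
Context {R : realType}.
Variable s : R.
Hypothesis s0 : 0 < s.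

Let g (u : R) := normal_fun 0 s u.
Let Phi (a : R) : R := fine (normal_prob 0 s `[a, +oo[).
Let c : R := s * Num.sqrt (pi *+ 2).

Let c0 : 0 < c.
Proof. by rewrite mulr_gt0// sqrtr_gt0 mulrn_wgt0// pi_gt0. Qed.

Let peakE : normal_peak s = c^-1.
Proof.
rewrite /normal_peak -mulrnAr sqrtrM ?sqr_ge0//.
by rewrite sqrtr_sqr ger0_norm ?ltW.
Qed.

Let g_le1 u : g u <= 1.
Proof.
rewrite /g /normal_fun -expR0 ler_expR mulNr oppr_le0 mulr_ge0 ?sqr_ge0//.
by rewrite invr_ge0 mulrn_wge0 ?sqr_ge0.
Qed.

Let Phi_ge0 a : 0 <= Phi a.
Proof. by rewrite fine_ge0. Qed.

Let Phi_le1 a : Phi a <= 1.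
Proof.
have := @probability_le1 _ _ R (normal_prob 0 s) `[a, +oo[ (measurable_itv _).
by move=> h; rewrite -lee_fin fineK// ge0_fin_numE// (le_lt_trans h)// ltry.
Qed.

Let Phi_step m a b : 0 <= m -> a <= b -> (forall u, a <= u < b -> m <= g u) ->
  m * (b - a) <= c * (Phi a - Phi b).
Proof.
move=> m0 ab mg.
have PhiE x : ((Phi x)%:E = normal_prob 0 s `[x, +oo[)%E.
  have := @probability_le1 _ _ R (normal_prob 0 s) `[x, +oo[ (measurable_itv _).
  by move=> h; rewrite fineK// ge0_fin_numE// (le_lt_trans h)// ltry.
have split : ((Phi a)%:E = normal_prob 0 s `[a, b[ + (Phi b)%:E)%E.
  rewrite !PhiE -(@measureU _ _ _ (normal_prob 0 s)) //.
  - congr (normal_prob _ _ _); apply/seteqP; split => x /=; rewrite !in_itv/= !andbT.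
      by move=> ax; have [xb|bx] := ltP x b; [left; rewrite ax|right].
    by move=> [/andP[]//|]; exact: le_trans.
  - rewrite -subset0 => x [] /=; rewrite !in_itv/= andbT => /andP[_ xb] bx.
    by move: (lt_le_trans xb bx); rewrite ltxx.
have lower : ((c^-1 * m * (b - a))%:E <= normal_prob 0 s `[a, b[)%E.
  apply: (@le_trans _ _ (\int[lebesgue_measure]_(x in `[a, b[) (c^-1 * m)%:E)%E).
    rewrite integral_cst//= lebesgue_measure_itv/= lte_fin.
    have [->|ab'] := eqVneq a b; first by rewrite ltxx subrr mulr0 mule0.
    by rewrite lt_neqAle ab' ab -EFinD -EFinM.
  apply: ge0_le_integral => //.
  - by move=> x _; rewrite lee_fin mulr_ge0// invr_ge0 ltW.
  - by apply/measurable_EFinP/measurable_funTS; exact: measurable_normal_pdf.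
  - move=> x /=; rewrite in_itv/= => xab; rewrite lee_fin normal_pdfE ?gt_eqF//.
    by rewrite peakE ler_wpM2l ?invr_ge0 ?(ltW c0)//; exact: mg.
rewrite -ler_pdivrMl// mulrA lerBrDr -lee_fin EFinD split leeD2r//.
Qed.

Let g_mono a b : 0 <= a -> a <= b -> g b <= g a.
Proof.
move=> a0 ab; rewrite /g /normal_fun ler_expR !mulNr lerN2 !subr0.
rewrite ler_wpM2r ?invr_ge0 ?mulrn_wge0 ?sqr_ge0//.
by rewrite ler_sqr// nnegrE// (le_trans a0).
Qed.

Let g_even a : g (- a) = g a.
Proof. by rewrite /g /normal_fun !subr0 sqrrN. Qed.

(** The main term is the whole Gaussian integral divided by the step. Uniformity in the offset [a]
    is essential, since the received word and the other codeword are arbitrary. *)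
Lemma normal_riemann_le h N a : 0 < h ->
  \sum_(k < N) normal_fun 0 s (a + h * k%:R) <= s * Num.sqrt (pi *+ 2) / h + 2.
Proof.
move=> h0; rewrite -(ler_pM2l h0) mulrDr mulrCA divff ?gt_eqF// mulr1.
apply: le_trans (@unimodal_riemann_le _ g (fun x => c * Phi x) h h0 _ g_even
  g_mono _ _ N a) _ => [u|u|m x y m0 xy mg|].
- by rewrite g_le1 normal_fun_ge0.
- by rewrite mulr_ge0// ltW.
- by rewrite -mulrBr; exact: Phi_step.
- rewrite addrC (mulrC 2) lerD2r -[leRHS]mulr1.
  by apply: ler_wpM2l; [exact: ltW|exact: Phi_le1].
Qed.

End gauss_riemann.

(** Lets compatible codewords be counted over the whole grid instead of the typical words only, so
    that the count factorizes over the coordinates. *)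
Lemma sum_sig_le (R : realType) (T : finType) (A : {set T}) (F : T -> R) :
  (forall x, 0 <= F x) -> \sum_(x : {x | x \in A}) F (val x) <= \sum_x F x.
Proof.
move=> F0; rewrite -(big_sub A F) big_mkcond; apply: ler_sum => x _.
by case: ifP.
Qed.

(** * Counting the grid words compatible with a received word *)

Section typical_count.
Context {R : realType}.
Variables (s d : R) (n N : nat) (D : R).
Hypothesis s0 : 0 < s.
Hypothesis D0 : 0 < D.

(** On a typical word, half of [n * (1 + d)] minus the sum of squares is nonnegative. The factor 1/2
    makes the right side a product of Gaussians, and its [exp (1 / 2)] together with [sqrt (2 pi)]
    is the origin of [sqrt (2 pi e)]. *)
Lemma typical_le_expR mu (y : n.-tuple R) :
  (typical s d mu y)%:R <=
  expR ((1 + d) / 2) ^+ n * \prod_(t < n) normal_fun 0 s (mu t - tnth y t).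
Proof.
rewrite /normal_fun -expR_sum -expRM_natl -expRD.
case: (boolP (typical _ _ _ _)) => [ty|_]; last exact: expR_ge0.
rewrite -[leLHS]expR0 ler_expR.
have -> : \sum_(t < n) (- (mu t - tnth y t - 0) ^+ 2 / (s ^+ 2 *+ 2)) =
    - (\sum_(t < n) ((tnth y t - mu t) / s) ^+ 2) / 2.
  rewrite -sumrN mulr_suml; apply: eq_bigr => t _.
  by field; rewrite gt_eqF.
by move: ty; rewrite /typical; lra.
Qed.

Lemma sum_typical_le h (v : nat -> R) (y : n.-tuple R) : 0 < h ->
  \sum_(x : {ffun 'I_n -> 'I_N})
    (typical s d (fun t => h * nth 0 [seq D * (x i)%:R | i <- enum 'I_n] t + v t) y)%:R
  <= (expR ((1 + d) / 2) * (s * Num.sqrt (pi *+ 2) / (h * D) + 2)) ^+ n.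
Proof.
move=> h0.
have hD0 : 0 < h * D by rewrite mulr_gt0.
apply: (@le_trans _ _ (\sum_(x : {ffun 'I_n -> 'I_N}) expR ((1 + d) / 2) ^+ n *
   \prod_(t < n) normal_fun 0 s (v t - tnth y t + h * D * (x t)%:R))).
  apply: ler_sum => x _; apply: (le_trans (typical_le_expR _ _)).
  rewrite ler_wpM2l ?exprn_ge0 ?expR_ge0// le_eqVlt; apply/orP; left; apply/eqP.
  apply: eq_bigr => t _; rewrite (nth_map t) ?size_enum_ord// nth_ord_enum.
  by congr normal_fun; ring.
rewrite -mulr_sumr exprMn ler_wpM2l ?exprn_ge0 ?expR_ge0//.
rewrite -(bigA_distr_bigA (fun (t : 'I_n) (k : 'I_N) =>
  normal_fun 0 s (v t - tnth y t + h * D * k%:R))) /=.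
rewrite -[in leRHS](card_ord n) -prodr_const; apply: ler_prod => t _.
by rewrite sumr_ge0 ?normal_riemann_le// => k _; exact: normal_fun_ge0.
Qed.

End typical_count.

(** * A Chernoff bound for weighted words *)

Section tilting.
Context {R : realType}.

(** Follows from [expR x * (1 - x) <= 1], as [(1 + x + 2 x^2) (1 - x) = 1 + x^2 (1 - 2 x)]. *)
Lemma expR_le_quadratic (x : R) : x <= 1 / 2 -> expR x <= 1 + x + 2 * x ^+ 2.
Proof.
move=> x2; have p : 0 < 1 - x by lra.
have : expR x * (1 - x) <= 1.
  by rewrite -[leRHS](expRxMexpNx_1 x) ler_wpM2l ?expR_ge0// -[1 - x]/(1 + - x) expR_ge1Dx.
have x3 : 0 <= x ^+ 2 * (1 - 2 * x) by rewrite mulr_ge0 ?sqr_ge0//; lra.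
move=> h; rewrite -(ler_pM2r p); apply: (le_trans h); nra.
Qed.

Variables (I : finType) (q : I -> R).
Hypothesis q0 : forall k, 0 <= q k.

(** The weights [q] are not normalized, so the bound is relative to the total weight of the words of
    length [n]. *)
Lemma chernoff n (y : I -> R) (del : R) : 0 <= del <= 1 ->
  (forall k, -1 <= y k <= 1) -> \sum_k q k * y k = 0 ->
  \sum_(x : {ffun 'I_n -> I} | n%:R * del < \sum_t y (x t)) \prod_t q (x t) <=
  ((\sum_k q k) * expR (- (del ^+ 2 / 8))) ^+ n.
Proof.
(* [del / 4] minimizes the final exponent [2 u^2 - u del] and keeps [u * y k] below 1/2. *)
move=> /andP[d0 d1] y1 y0; pose u := del / 4.
apply: (@le_trans _ _ (\sum_(x : {ffun 'I_n -> I})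
    \prod_t (q (x t) * expR (u * (y (x t) - del))))).
  rewrite big_mkcond; apply: ler_sum => x _; rewrite big_split/=.
  case: ifPn => [dx|_]; last first.
    by rewrite mulr_ge0// prodr_ge0// => t _; exact: expR_ge0.
  rewrite ler_peMr ?prodr_ge0// -expR_sum -[leLHS]expR0 ler_expR -mulr_sumr.
  rewrite mulr_ge0//; first by rewrite /u; lra.
  by rewrite sumrB sumr_const card_ord subr_ge0 -[leLHS]mulr_natl ltW.
rewrite -(bigA_distr_bigA (fun (_ : 'I_n) k => q k * expR (u * (y k - del)))) /=.
rewrite prodr_const card_ord; apply: lerXn2r; rewrite ?nnegrE.
- by apply: sumr_ge0 => k _; rewrite mulr_ge0// expR_ge0.
- by rewrite mulr_ge0 ?expR_ge0// sumr_ge0.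
apply: (@le_trans _ _ (\sum_k (q k * (1 + u * y k + 2 * u ^+ 2)) * expR (- (u * del)))).
  apply: ler_sum => k _; rewrite mulrBr expRD mulrA ler_wpM2r ?expR_ge0// ler_wpM2l//.
  have /andP[ya yb] := y1 k.
  have y2 : y k ^+ 2 <= 1 by nra.
  have uy : u * y k <= 1 / 2 by rewrite /u; nra.
  apply: (le_trans (expR_le_quadratic uy)); rewrite lerD2l ler_wpM2l// exprMn.
  by rewrite ler_piMr ?sqr_ge0.
have -> : \sum_k (q k * (1 + u * y k + 2 * u ^+ 2)) * expR (- (u * del)) =
    (\sum_k q k) * ((1 + 2 * u ^+ 2) * expR (- (u * del))).
  rewrite mulrA -mulr_suml; congr (_ * _).
  transitivity (\sum_k (q k * (1 + 2 * u ^+ 2) + u * (q k * y k))).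
    by apply: eq_bigr => k _; ring.
  by rewrite big_split/= -mulr_sumr y0 mulr0 addr0 -mulr_suml.
rewrite ler_wpM2l ?sumr_ge0//.
apply: (@le_trans _ _ (expR (2 * u ^+ 2) * expR (- (u * del)))).
  by rewrite ler_wpM2r ?expR_ge0// expR_ge1Dx.
by rewrite -expRD ler_expR /u; lra.
Qed.

End tilting.

(** * The typical set of an exponentially tilted law *)

Section tilted_typical.
Context {R : realType}.
Variables (I : finType) (x : I -> R) (mu : R).
Hypothesis x01 : forall k, 0 <= x k <= 1.
Hypothesis I0 : (0 < #|I|)%N.
Hypothesis mu0 : 0 <= mu.

Definition partition_fun : R := \sum_k expR (- (mu * x k)).

Definition tilted_mean : R := (\sum_k expR (- (mu * x k)) * x k) / partition_fun.

Lemma partition_fun_gt0 : 0 < partition_fun.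
Proof.
case/card_gt0P: I0 => k _; rewrite /partition_fun (bigD1 k)//=.
by rewrite ltr_pwDl ?expR_gt0// sumr_ge0// => j _; exact: expR_ge0.
Qed.

Lemma tilted_mean01 : 0 <= tilted_mean <= 1.
Proof.
have Z0 := partition_fun_gt0; apply/andP; split.
  rewrite divr_ge0 ?(ltW Z0)// sumr_ge0// => k _.
  by rewrite mulr_ge0 ?expR_ge0//; case/andP: (x01 k).
rewrite ler_pdivrMr// mul1r; apply: ler_sum => k _.
by rewrite ler_piMr ?expR_ge0//; case/andP: (x01 k).
Qed.

(** Both sides of the deviation matter: the upper one yields the average constraint, the lower one
    caps the weight of a word. *)
Definition tilted_typical n (del : R) : {set {ffun 'I_n -> I}} :=
  [set c : {ffun 'I_n -> I} | `|\sum_t (x (c t) - tilted_mean)| <= n%:R * del].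

(** Typical words carry all of the total weight [Z^n] but an exponentially small fraction, and each
    weighs at most [exp (- mu (m - del))^n]; the quotient bounds their number. *)
Lemma card_tilted_typical_ge n del : 0 <= del <= 1 ->
  (partition_fun * expR (mu * (tilted_mean - del))) ^+ n *
    (1 - 2 * expR (- (del ^+ 2 / 8)) ^+ n) <= #|tilted_typical n del|%:R.
Proof.
move=> del01; set m := tilted_mean; set G := tilted_typical n del.
set Z := partition_fun; have Z0 : 0 < Z := partition_fun_gt0.
pose q k := expR (- (mu * x k)).
have q0 k : 0 <= q k by exact: expR_ge0.
have /andP[m0 m1] : 0 <= m <= 1 := tilted_mean01.
pose y k := x k - m.
have y1 k : -1 <= y k <= 1.
  by have /andP[] := x01 k; rewrite /y => *; apply/andP; split; lra.
have qy : \sum_k q k * y k = 0.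
  under eq_bigr do rewrite mulrBr.
  have qx : \sum_k q k * x k = Z * m.
    by rewrite mulrC /m /tilted_mean divfK ?gt_eqF.
  by rewrite sumrB -mulr_suml qx subrr.
have qyN : \sum_k q k * - y k = 0.
  by under eq_bigr do rewrite mulrN; rewrite sumrN qy oppr0.
have up := chernoff q0 n del01 y1 qy.
have y1N k : -1 <= - y k <= 1 by have /andP[] := y1 k; move=> *; apply/andP; split; lra.
have lo := chernoff q0 n del01 y1N qyN.
have tot : \sum_(c : {ffun 'I_n -> I}) \prod_t q (c t) = Z ^+ n.
  by rewrite -(bigA_distr_bigA (fun (_ : 'I_n) k => q k)) /= prodr_const card_ord.
have bad : \sum_(c : {ffun 'I_n -> I} | c \notin G) \prod_t q (c t) <=
    2 * (Z * expR (- (del ^+ 2 / 8))) ^+ n.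
  rewrite mulr_natl mulr2n; apply: le_trans (lerD up lo).
  rewrite big_mkcond [X in _ <= X + _]big_mkcond [X in _ <= _ + X]big_mkcond.
  rewrite -big_split/=; apply: ler_sum => c _.
  have P0 : 0 <= \prod_t q (c t) by rewrite prodr_ge0.
  case: ifPn => [|_]; last by rewrite addr_ge0//; case: ifP.
  rewrite inE -ltNge /y -/m sumrN.
  case: (lerP 0 (\sum_t (x (c t) - m))) => S0.
    by rewrite ger0_norm// => ->; rewrite lerDl; case: ifP.
  by rewrite ltr0_norm// => ->; rewrite lerDr; case: ifP.
have good : \sum_(c in G) \prod_t q (c t) <=
    #|G|%:R * expR (- (mu * (m - del))) ^+ n.
  rewrite mulr_natl -sumr_const; apply: ler_sum => c.
  rewrite inE -/m ler_norml sumrB sumr_const card_ord -mulr_natl => /andP[cG _].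
  rewrite /q -expR_sum -expRM_natl ler_expR sumrN -mulr_sumr -/m.
  by rewrite mulrN lerN2 mulrCA ler_wpM2l//; move: cG; rewrite mulrBr; lra.
rewrite [X in _ <= X](_ : _ = #|G|%:R * expR (- (mu * (m - del))) ^+ n *
    expR (mu * (m - del)) ^+ n); last first.
  by rewrite -mulrA -exprMn -expRD addNr expR0 expr1n mulr1.
rewrite exprMn mulrAC ler_wpM2r ?exprn_ge0 ?expR_ge0//.
apply: le_trans good.
rewrite -(lerD2r (\sum_(c : {ffun 'I_n -> I} | c \notin G) \prod_t q (c t))).
rewrite -(bigID (fun c => c \in G) xpredT) /= tot.
by move: bad; rewrite exprMn; lra.
Qed.

End tilted_typical.

(** * Codes on a fine grid *)

Section achievability.
Context {R : realType}.

Lemma nmsg_gt0 n (r : R) : (0 < nmsg n r)%N.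
Proof.
rewrite /nmsg absz_gt0 gt_eqF// ceil_gt0 powR_gt0//.
Qed.

Lemma nmsg_le n (r : R) : 0 <= r -> (nmsg n r)%:R <= 2 * (2 `^ r) ^+ n.
Proof.
move=> r0; rewrite /nmsg -[in leRHS]powR_mulrn ?powR_ge0// -powRrM (mulrC r).
set x := 2 `^ _.
have x1 : 1 <= x.
  by rewrite -(powRr0 2) ler_powR ?mulr_ge0//; lra.
have c0 : 0 <= Num.ceil x by rewrite ceil_ge0; lra.
rewrite natr_absz ger0_norm//.
have := ceilB1_lt x; rewrite intrD; lra.
Qed.

Lemma gprob_ge0 s n mu (S : set (n.-tuple R)) : 0 <= gprob s mu S.
Proof. by rewrite fine_ge0// gexp_ge0// => y; rewrite lee_fin indicE. Qed.

Lemma achievable_of_geometric (h11 h12 h21 h22 s A alpha q1 q2 C theta : R) n0 :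
  0 <= A -> 0 <= alpha -> 0 <= theta < 1 ->
  (forall n, (n0 <= n)%N -> exists c : Defs.code A alpha alpha n (nmsg n q1) (nmsg n q2),
     Pe1 h11 h21 s c + Pe2 h12 h22 s c <= C * theta ^+ n) ->
  achievable h11 h12 h21 h22 s A alpha alpha q1 q2.
Proof.
move=> A0 al0 /andP[th0 th1] codes.
(* A code is required for every [n]; below [n0] zero codewords with constant decoders do. *)
have zero n : Defs.code A alpha alpha n (nmsg n q1) (nmsg n q2).
  pose z : n.-tuple R := [tuple 0 | i < n].
  have z0 t : nth 0 (z : seq R) t = 0.
    have [tn|nt] := ltnP t n; last by rewrite nth_default ?size_tuple.
    by rewrite -[t]/(val (Ordinal tn)) -tnth_nth tnth_mktuple.
  have zp t : 0 <= nth 0 (z : seq R) t <= A by rewrite z0 lexx.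
  have za : \sum_(t < n) nth 0 (z : seq R) t <= n%:R * (alpha * A).
    by rewrite big1 ?mulr_ge0// => t _; rewrite z0.
  have mc M (m0 : 'I_M) (m : 'I_M) : measurable ((fun _ : n.-tuple R => m0) @^-1` [set m]).
    by rewrite preimage_cst; case: ifP.
  exact: (@Code R A alpha alpha n _ _ (fun _ => z) (fun _ => z)
    (fun _ => Ordinal (nmsg_gt0 n q1)) (fun _ => Ordinal (nmsg_gt0 n q2))
    (fun _ => zp) (fun _ => zp) (fun _ => za) (fun _ => za) (mc _ _) (mc _ _)).
have choose n : {c : Defs.code A alpha alpha n (nmsg n q1) (nmsg n q2) |
    (n0 <= n)%N -> Pe1 h11 h21 s c + Pe2 h12 h22 s c <= C * theta ^+ n}.
  apply: cid; have [/codes[c Pc]|] := leqP n0 n; first by exists c.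
  by exists (zero n).
exists (fun n => sval (choose n)).
have lim : (fun n => C * theta ^+ n) @ \oo --> (0 : R).
  rewrite -(mulr0 C); apply: cvgM; first exact: cvg_cst.
  by apply: cvg_expr; rewrite ger0_norm.
have Pe1_ge0 n (c : Defs.code A alpha alpha n (nmsg n q1) (nmsg n q2)) :
    0 <= Pe1 h11 h21 s c.
  by rewrite divr_ge0//; do 2! apply: sumr_ge0 => ? _; exact: gprob_ge0.
have Pe2_ge0 n (c : Defs.code A alpha alpha n (nmsg n q1) (nmsg n q2)) :
    0 <= Pe2 h12 h22 s c.
  by rewrite divr_ge0//; do 2! apply: sumr_ge0 => ? _; exact: gprob_ge0.
split; apply: (squeeze_cvgr _ (cvg_cst 0) lim); exists n0 => // n /= n0n;
  rewrite ?Pe1_ge0 ?Pe2_ge0/=; apply: le_trans (svalP (choose n) n0n).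
- by rewrite lerDl.
- by rewrite lerDr.
Qed.

(** The Chernoff parameter [e / (4 (1 + e))] is half the optimal one. With it the weak bound
    [expR x >= 1 + x] suffices, because [a * (1 + e / 2) = 1 + e^2 / (4 (1 + e))] exceeds 1. *)
Lemma noise_base_lt1 (e : R) : 0 < e ->
  (Num.sqrt (1 - 2 * (e / (4 * (1 + e)))))^-1 *
  expR (- (e / (4 * (1 + e)) * (1 + e))) < 1.
Proof.
move=> e0; have -> : e / (4 * (1 + e)) * (1 + e) = e / 4 by field; lra.
have -> : 1 - 2 * (e / (4 * (1 + e))) = (2 + e) / (2 * (1 + e)) by field; lra.
set a := _ / _; have a0 : 0 < a by rewrite divr_gt0; lra.
rewrite expRN -invfM invf_lt1 ?mulr_gt0 ?sqrtr_gt0 ?expR_gt0//.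
have -> : Num.sqrt a * expR (e / 4) = Num.sqrt (a * expR (2 * (e / 4))).
  rewrite expRM_natl [RHS]sqrtrM ?(ltW a0)// sqrtr_sqr ger0_norm ?expR_ge0//.
rewrite -[X in X < _]sqrtr1 ltr_sqrt ?(mulr_gt0 a0 (expR_gt0 _))//.
apply: (@lt_le_trans _ _ (a * (1 + 2 * (e / 4)))); last first.
  by rewrite ler_wpM2l ?(ltW a0)// expR_ge1Dx.
rewrite /a mulrAC ltr_pdivlMr; [nra|lra].
Qed.

(* Uniformly over the grids [k / N], the law with weights [exp (- mu k / N)] has
   partition function at least [N * zeta] and mean [alpha] up to [1 / N]; for
   [mu = 0] the mean only has to be at most [alpha]. *)
Definition tilt (alpha mu zeta : R) : Prop :=
  [/\ 0 <= mu, 0 < zeta & forall N, (0 < N)%N ->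
    let x (k : 'I_N) := k%:R / N%:R in
    [/\ N%:R * zeta <= partition_fun x mu, tilted_mean x mu <= alpha
      & mu * (alpha - N%:R^-1) <= mu * tilted_mean x mu]].

(* Per time instant, [gain] bounds the number of codewords that a received word
   can be confused with and [volume] bounds the number of available codewords
   from below; the codeword entries are multiples of
   [A * alpha / (alpha + e) / N]. *)
Definition gain (s A alpha e h : R) N : R :=
  expR ((1 + e) / 2) * (s * Num.sqrt (pi *+ 2) / (h * (A * alpha / (alpha + e) / N%:R)) + 2).

Definition volume (alpha mu zeta e : R) N : R :=
  N%:R * zeta * expR (mu * (alpha - N%:R^-1 - e)).

Lemma tilted_code (h11 h12 h21 h22 s A alpha mu zeta e ha hb : R) n N M1 M2 :
  0 < h11 -> 0 < h12 -> 0 < h21 -> 0 < h22 -> 0 < s -> 0 < A -> 0 < alpha ->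
  tilt alpha mu zeta -> 0 < e <= 1 -> (0 < N)%N ->
  2 * expR (- (e ^+ 2 / 8)) ^+ n <= 1 / 2 ->
  (0 < M1)%N -> (0 < M2)%N ->
  ha = h11 \/ ha = h21 -> hb = h22 \/ hb = h12 ->
  let rho h := gain s A alpha e h N / volume alpha mu zeta e N in
  let kappa := (Num.sqrt (1 - 2 * (e / (4 * (1 + e)))))^-1 *
               expR (- (e / (4 * (1 + e)) * (1 + e))) in
  exists c : Defs.code A alpha alpha n M1 M2,
    Pe1 h11 h21 s c + Pe2 h12 h22 s c <=
    (kappa ^+ n + M1%:R * (2 * rho h11 ^+ n) + (M1 * M2)%:R * (2 * rho ha ^+ n)) +
    (kappa ^+ n + M2%:R * (2 * rho h22 ^+ n) + (M1 * M2)%:R * (2 * rho hb ^+ n)).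
Proof.
move=> h110 h120 h210 h220 s0 A0 al0 [mu0 zeta0 tiltN] /andP[e0 e1] N0 n_large
  M10 M20 haE hbE rho kappa.
have {tiltN} [Zge mle mge] := tiltN N N0.
pose x (k : 'I_N) : R := k%:R / N%:R.
have NR0 : (0 : R) < N%:R by rewrite ltr0n.
have x01 k : 0 <= x k <= 1.
  by rewrite divr_ge0//= ler_pdivrMr// mul1r ler_nat ltnW.
have I0 : (0 < #|'I_N|)%N by rewrite card_ord.
pose G := tilted_typical x mu n e.
pose X : finType := {c : {ffun 'I_n -> 'I_N} | c \in G}.
(* The factor [alpha / (alpha + e)] makes up for the slack [e] in the mean of a typical word. *)
pose D := A * alpha / (alpha + e) / N%:R.
have ale0 : 0 < alpha + e by rewrite addr_gt0.
have D0 : 0 < D by rewrite !divr_gt0// mulr_gt0.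
have DN : D * N%:R = A * alpha / (alpha + e) by rewrite divfK ?gt_eqF.
pose w (c : X) : n.-tuple R := [tuple D * (sval c i)%:R | i < n].
have w_nth c (t : 'I_n) : nth 0 (w c : seq R) t = D * (sval c t)%:R.
  by rewrite -tnth_nth tnth_mktuple.
have w_peak c t : 0 <= nth 0 (w c : seq R) t <= A.
  have [tn|nt] := ltnP t n; last by rewrite nth_default ?size_tuple// lexx ltW.
  rewrite (w_nth c (Ordinal tn)) mulr_ge0 ?(ltW D0)//=.
  apply: (@le_trans _ _ (D * N%:R)); first by rewrite ler_wpM2l ?(ltW D0)// ler_nat ltnW.
  by rewrite DN ler_pdivrMr// ler_wpM2l ?(ltW A0)// lerDl ltW.
have w_avg c : \sum_(t < n) nth 0 (w c : seq R) t <= n%:R * (alpha * A).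
  have := svalP c; rewrite inE => /ler_normlW.
  rewrite sumrB sumr_const card_ord => cG.
  have -> : \sum_(t < n) nth 0 (w c : seq R) t =
      A * alpha / (alpha + e) * \sum_(t < n) x (sval c t).
    rewrite mulr_sumr; apply: eq_bigr => t _.
    by rewrite w_nth -DN /x; field; rewrite gt_eqF.
  have avg : \sum_(t < n) x (sval c t) <= n%:R * (alpha + e).
    have nm : n%:R * tilted_mean x mu <= n%:R * alpha by rewrite ler_wpM2l.
    by move: cG nm; rewrite -mulr_natl mulrDr; lra.
  apply: (le_trans (ler_wpM2l _ avg)); first by rewrite -DN mulr_ge0// ltW.
  by rewrite le_eqVlt; apply/orP; left; apply/eqP; field; rewrite gt_eqF.
(* By [n_large] at least half of the total weight is typical; this half becomes the factor 2 in
   front of each power of [rho]. *)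
have Ggt : (1 / 2) * volume alpha mu zeta e N ^+ n <= #|X|%:R.
  rewrite card_sig; apply: le_trans (card_tilted_typical_ge x01 I0 mu0 n _); last first.
    by rewrite ltW.
  rewrite mulrC; apply: ler_pM => //.
  - by rewrite exprn_ge0// !mulr_ge0 ?expR_ge0// ltW.
  - apply: lerXn2r; rewrite ?nnegrE.
    + by rewrite !mulr_ge0 ?expR_ge0// ltW.
    + by rewrite mulr_ge0 ?expR_ge0// ltW// partition_fun_gt0.
    apply: ler_pM => //; first by rewrite mulr_ge0// ltW.
    by rewrite ler_expR !mulrBr lerD2r -mulrBr.
  - by move: n_large; lra.
have vol0 : 0 < volume alpha mu zeta e N by rewrite !mulr_gt0// expR_gt0.
have XR0 : (0 : R) < #|X|%:R.
  by apply: lt_le_trans Ggt; rewrite mulr_gt0 ?exprn_gt0.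
have X0 : (0 < #|X|)%N by rewrite -(ltr0n R).
pose B h := gain s A alpha e h N ^+ n.
have B_ge h (v : nat -> R) (y : n.-tuple R) : 0 < h ->
    \sum_c (typical s e (fun t => h * nth 0 (w c : seq R) t + v t) y)%:R <= B h.
  move=> h0; apply: (le_trans _ (@sum_typical_le R s e n N D s0 D0 h v y h0)).
  exact: (@sum_sig_le R _ G (fun c => (typical s e (fun t =>
    h * nth 0 [seq D * (c i)%:R | i <- enum 'I_n] t + v t) y)%:R)).
have gain0 h : 0 < h -> 0 <= gain s A alpha e h N.
  move=> h0; rewrite mulr_ge0 ?expR_ge0// addr_ge0//.
  by rewrite divr_ge0// mulr_ge0// ltW.
have B0 h : 0 < h -> 0 <= B h by move=> h0; rewrite exprn_ge0// gain0.
have atyp nu : gprob s nu [set y : n.-tuple R | ~~ typical s e nu y] <= kappa ^+ n.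
  apply: atypical_gprob_le => //; first by rewrite divr_ge0//; lra.
  by rewrite mulrA ltr_pdivrMr; lra.
have ha0 : 0 < ha by case: haE => ->.
have hb0 : 0 < hb by case: hbE => ->.
have [c Pc] := @exists_code R h11 h12 h21 h22 s A alpha n e X w X0 w_peak w_avg
  (kappa ^+ n) B atyp B_ge M1 M2 (B ha) (B hb) M10 M20 h110 h120 h210 h220
  (B0 _ h110) (B0 _ h220) (B0 _ ha0) (B0 _ hb0)
  (ltac:(case: haE => ->; [left|right]; reflexivity))
  (ltac:(case: hbE => ->; [left|right]; reflexivity)).
exists c; apply: (le_trans Pc).
have BX h : 0 < h -> B h / #|X|%:R <= 2 * rho h ^+ n.
  move=> h0; rewrite ler_pdivrMr// /rho expr_div_n /B.
  have g0 : 0 <= gain s A alpha e h N ^+ n by rewrite exprn_ge0// gain0.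
  have v0 : 0 < volume alpha mu zeta e N ^+ n by rewrite exprn_gt0.
  apply: (@le_trans _ _ (2 * (gain s A alpha e h N ^+ n / volume alpha mu zeta e N ^+ n) *
     (1 / 2 * volume alpha mu zeta e N ^+ n))).
    by rewrite le_eqVlt; apply/orP; left; apply/eqP; field; rewrite gt_eqF.
  by rewrite ler_wpM2l// mulr_ge0// divr_ge0// ltW.
by apply: lerD; apply: lerD; rewrite ?lerD2l ler_wpM2l// BX.
Qed.

End achievability.

(** * Achievable rates at a fixed signal-to-noise ratio *)

Section achievable_rates.
Context {R : realType}.

(* [exp] of the differential entropy (in nats) of the maximum entropy input on
   [0, 1], minus that of the standard normal noise. *)
Definition snr_factor (alpha mu zeta : R) : R :=
  zeta * expR (mu * alpha) / (Num.sqrt (pi *+ 2) * expR (1 / 2)).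

Lemma sqrt2pi_gt0 : 0 < Num.sqrt (pi *+ 2) :> R.
Proof. by rewrite sqrtr_gt0 mulrn_wgt0// pi_gt0. Qed.

(** Bounds [gain / volume] with [N^-1] replaced by [e], so that [e] alone has to tend to 0. *)
Definition ratio_bound (s A alpha mu zeta h e : R) : R :=
  expR ((1 + e) / 2 - mu * (alpha - 2 * e)) *
  (s * Num.sqrt (pi *+ 2) * (alpha + e) / (h * A * alpha) + 2 * e) / zeta.

Lemma gain_volume_le (s A alpha mu zeta h e : R) N :
  0 < s -> 0 < A -> 0 < alpha -> 0 < h -> 0 <= mu -> 0 < zeta -> 0 < e ->
  (0 < N)%N -> N%:R^-1 <= e ->
  gain s A alpha e h N / volume alpha mu zeta e N <=
  ratio_bound s A alpha mu zeta h e.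
Proof.
move=> s0 A0 al0 h0 mu0 z0 e0 N0 Ne; have c0 := sqrt2pi_gt0.
have NR0 : (0 : R) < N%:R by rewrite ltr0n.
have ale0 : 0 < alpha + e by rewrite addr_gt0.
rewrite /gain /volume /ratio_bound; set c := Num.sqrt _ in c0 *.
have -> : expR ((1 + e) / 2) * (s * c / (h * (A * alpha / (alpha + e) / N%:R)) + 2) /
    (N%:R * zeta * expR (mu * (alpha - N%:R^-1 - e))) =
    expR ((1 + e) / 2 - mu * (alpha - N%:R^-1 - e)) *
    (s * c * (alpha + e) / (h * A * alpha) + 2 * N%:R^-1) / zeta.
  by rewrite expRB; field; rewrite !gt_eqF ?expR_gt0.
rewrite ler_wpM2r ?invr_ge0 ?(ltW z0)//.
have k0 : 0 <= s * c * (alpha + e) / (h * A * alpha).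
  by rewrite divr_ge0// ltW// !mulr_gt0.
apply: ler_pM; rewrite ?expR_ge0//.
- by rewrite addr_ge0// mulr_ge0// invr_ge0 ltW.
- by rewrite ler_expR; nra.
- by rewrite lerD2l ler_wpM2l.
Qed.

Lemma ratio_bound_cvg (s A alpha mu zeta h : R) :
  0 < alpha -> 0 < h -> 0 < A -> 0 < zeta ->
  ratio_bound s A alpha mu zeta h e @[e --> 0^'+] -->
  s / (h * A) / snr_factor alpha mu zeta.
Proof.
move=> al0 h0 A0 z0; have c0 := sqrt2pi_gt0.
have id0 : (e : R) @[e --> (0 : R)^'+] --> (0 : R).
  exact: cvg_at_right_filter.
have lin (a b : R) : (a + b * e) @[e --> (0 : R)^'+] --> a.
  rewrite -[X in _ --> X]addr0 -[X in _ --> _ + X](mulr0 b).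
  by apply: cvgD; [exact: cvg_cst|apply: cvgM => //; exact: cvg_cst].
have -> : s / (h * A) / snr_factor alpha mu zeta =
    expR (1 / 2 - mu * alpha) * (s * Num.sqrt (pi *+ 2) / (h * A)) / zeta.
  rewrite /snr_factor expRB.
  by field; rewrite !gt_eqF ?expR_gt0.
set c := Num.sqrt _ in c0 *.
have E e : ratio_bound s A alpha mu zeta h e =
    expR ((1 / 2 - mu * alpha) + (1 / 2 + 2 * mu) * e) *
    (s * c / (h * A) + (s * c / (h * A * alpha) + 2) * e) / zeta.
  rewrite /ratio_bound -/c; congr (expR _ * _ / _); first by ring.
  by field; rewrite !gt_eqF.
under eq_cvg do rewrite E.
apply: cvgM; last exact: cvg_cst.
apply: cvgM; last exact: lin.
by apply: continuous_cvg; [exact: continuous_expR|exact: lin].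
Qed.

Lemma ratio_bound_near (s A alpha mu zeta h P : R) :
  0 < s -> 0 < alpha -> 0 < h -> 0 < A -> 0 < zeta ->
  0 < P -> P < snr_factor alpha mu zeta * (h * A / s) ->
  \forall e \near 0^'+, P * ratio_bound s A alpha mu zeta h e < 1.
Proof.
move=> s0 al0 h0 A0 z0 P0 PL.
have L0 : 0 < snr_factor alpha mu zeta.
  by rewrite divr_gt0 ?mulr_gt0 ?expR_gt0 ?sqrt2pi_gt0.
have := @ratio_bound_cvg s A alpha mu zeta h al0 h0 A0 z0.
move=> /(cvgr_lt _) /(_ P^-1); rewrite /=.
set L := snr_factor _ _ _ in L0 PL *.
have : s / (h * A) / L < P^-1.
  have -> : s / (h * A) / L = (L * (h * A / s))^-1 by field; rewrite !gt_eqF.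
  have p : 0 < L * (h * A / s) by rewrite mulr_gt0// divr_gt0// mulr_gt0.
  by rewrite ltf_pV2.
move=> + H => /H; apply: filterS => e.
by rewrite -(ltr_pM2l P0) divff ?gt_eqF.
Qed.

Lemma achievable_rates (h11 h12 h21 h22 s A alpha mu zeta q1 q2 ha hb : R) :
  0 < h11 -> 0 < h12 -> 0 < h21 -> 0 < h22 -> 0 < s -> 0 < A -> 0 < alpha ->
  tilt alpha mu zeta -> 0 <= q1 -> 0 <= q2 ->
  ha = h11 \/ ha = h21 -> hb = h22 \/ hb = h12 ->
  2 `^ q1 < snr_factor alpha mu zeta * (h11 * A / s) ->
  2 `^ q2 < snr_factor alpha mu zeta * (h22 * A / s) ->
  2 `^ (q1 + q2) < snr_factor alpha mu zeta * (ha * A / s) ->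
  2 `^ (q1 + q2) < snr_factor alpha mu zeta * (hb * A / s) ->
  achievable h11 h12 h21 h22 s A alpha alpha q1 q2.
Proof.
move=> h110 h120 h210 h220 s0 A0 al0 tlt q10 q20 haE hbE r1 r2 ra rb.
have [mu0 z0 _] := tlt.
have ha0 : 0 < ha by case: haE => ->.
have hb0 : 0 < hb by case: hbE => ->.
have p2 (q : R) : 0 < 2 `^ q by exact: powR_gt0.
(* The strict rate inequalities hold in the limit, hence for some positive [e]; the grid size [N] is
   chosen after [e]. *)
have [e [e0 e1 [l1 l2 la lb]]] : exists e, [/\ 0 < e, e <= 1 &
    [/\ 2 `^ q1 * ratio_bound s A alpha mu zeta h11 e < 1,
        2 `^ q2 * ratio_bound s A alpha mu zeta h22 e < 1,
        2 `^ (q1 + q2) * ratio_bound s A alpha mu zeta ha e < 1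
      & 2 `^ (q1 + q2) * ratio_bound s A alpha mu zeta hb e < 1]].
  have n1 := ratio_bound_near s0 al0 h110 A0 z0 (p2 q1) r1.
  have n2 := ratio_bound_near s0 al0 h220 A0 z0 (p2 q2) r2.
  have na := ratio_bound_near s0 al0 ha0 A0 z0 (p2 (q1 + q2)) ra.
  have nb := ratio_bound_near s0 al0 hb0 A0 z0 (p2 (q1 + q2)) rb.
  have npos : \forall e \near (0 : R)^'+, 0 < e by exact: nbhs_right_gt.
  have nle : \forall e \near (0 : R)^'+, e <= 1 by exact: nbhs_right_le.
  near (0 : R)^'+ => e; exists e; split; [by near: e..|split; by near: e].
have [N [N0 Ne]] : exists N, (0 < N)%N /\ N%:R^-1 <= e.
  exists (Num.truncn e^-1).+1; split => //.
  by rewrite invf_ple ?posrE// ltW// truncnS_gt.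
set kappa := (Num.sqrt (1 - 2 * (e / (4 * (1 + e)))))^-1 *
   expR (- (e / (4 * (1 + e)) * (1 + e))).
have kappa1 : kappa < 1 by exact: noise_base_lt1.
have kappa0 : 0 <= kappa by rewrite mulr_ge0 ?invr_ge0 ?expR_ge0.
pose rho h := gain s A alpha e h N / volume alpha mu zeta e N.
have rho0 h : 0 < h -> 0 <= rho h.
  move=> h0; have c0 := sqrt2pi_gt0; rewrite divr_ge0// ltW//.
    have ae0 : 0 < alpha + e by rewrite addr_gt0.
    by rewrite mulr_gt0 ?expR_gt0// addr_gt0// divr_gt0// !mulr_gt0// ?invr_gt0 ?ltr0n.
  by rewrite !mulr_gt0 ?expR_gt0// ltr0n.
have rhole h q : 0 < h -> 2 `^ q * ratio_bound s A alpha mu zeta h e < 1 ->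
    2 `^ q * rho h < 1.
  move=> h0; apply: le_lt_trans; rewrite ler_wpM2l ?(ltW (p2 _))//.
  exact: gain_volume_le.
pose theta := Num.max kappa (Num.max (Num.max (2 `^ q1 * rho h11) (2 `^ q2 * rho h22))
  (Num.max (2 `^ (q1 + q2) * rho ha) (2 `^ (q1 + q2) * rho hb))).
have th1 : theta < 1 by rewrite !gt_max kappa1 !rhole.
have th0 : 0 <= theta by rewrite le_max kappa0.
pose c8 := expR (- (e ^+ 2 / 8)).
have [n0 n0P] : exists n0, forall n, (n0 <= n)%N -> 2 * c8 ^+ n <= 1 / 2.
  have : (fun n => c8 ^+ n) @ \oo --> (0 : R).
    apply: cvg_expr; rewrite ger0_norm ?expR_ge0// -[ltRHS]expR0 ltr_expR.
    by rewrite oppr_lt0 divr_gt0 ?exprn_gt0.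
  move=> /(cvgr_lt _) /(_ (1 / 4)) [|n0 _ n0P]; first by rewrite divr_gt0.
  by exists n0 => n /n0P /= H; move: H; lra.
(* [26 = 2 * 1 + 2 * 4 + 2 * 8]: two noise terms, two single-user terms, two pair terms. *)
apply: (@achievable_of_geometric _ _ _ _ _ _ _ _ _ _ 26 theta n0).
- exact: ltW.
- exact: ltW.
- by rewrite th0.
move=> n nn0.
have [c Pc] := @tilted_code R h11 h12 h21 h22 s A alpha mu zeta e ha hb n N
  (nmsg n q1) (nmsg n q2) h110 h120 h210 h220 s0 A0 al0 tlt
  (introT andP (conj e0 e1)) N0 (n0P n nn0) (nmsg_gt0 n q1) (nmsg_gt0 n q2) haE hbE.
exists c; apply: (le_trans Pc); rewrite -/kappa -!/(rho _).
have term x : 0 <= x -> x <= theta -> x ^+ n <= theta ^+ n.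
  by move=> x0 xt; apply: lerXn2r; rewrite ?nnegrE.
have tk : kappa ^+ n <= theta ^+ n by apply: term => //; rewrite le_max lexx.
have rho_term h q : 0 < h -> 2 `^ q * rho h <= theta ->
    (2 `^ q) ^+ n * rho h ^+ n <= theta ^+ n.
  move=> h0 hq; rewrite -exprMn; apply: term => //.
  by rewrite mulr_ge0 ?rho0// ltW.
have M1 := nmsg_le n q10; have M2 := nmsg_le n q20.
have M12 : ((nmsg n q1 * nmsg n q2)%N)%:R <= 4 * (2 `^ (q1 + q2)) ^+ n :> R.
  rewrite natrM powRD ?pnatr_eq0//; last by apply/implyP.
  rewrite exprMn (_ : 4 * _ = 2 * (2 `^ q1) ^+ n * (2 * (2 `^ q2) ^+ n)); last by ring.
  exact: ler_pM.
have single h q (M : R) C : 0 < h -> 0 <= C -> M <= C * (2 `^ q) ^+ n ->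
    2 `^ q * rho h <= theta -> M * (2 * rho h ^+ n) <= 2 * C * theta ^+ n.
  move=> h0 C0 MC hq; have rn0 : 0 <= rho h ^+ n by rewrite exprn_ge0 ?rho0.
  apply: (@le_trans _ _ (C * (2 `^ q) ^+ n * (2 * rho h ^+ n))).
    by rewrite ler_wpM2r// mulr_ge0.
  rewrite (_ : C * _ * _ = 2 * C * ((2 `^ q) ^+ n * rho h ^+ n)); last by ring.
  by rewrite ler_wpM2l ?mulr_ge0// rho_term.
have t1 : (nmsg n q1)%:R * (2 * rho h11 ^+ n) <= 2 * 2 * theta ^+ n.
  by apply: single M1 _ => //; rewrite !le_max lexx ?orbT.
have t2 : (nmsg n q2)%:R * (2 * rho h22 ^+ n) <= 2 * 2 * theta ^+ n.
  by apply: single M2 _ => //; rewrite !le_max lexx ?orbT.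
have ta : ((nmsg n q1 * nmsg n q2)%N)%:R * (2 * rho ha ^+ n) <= 2 * 4 * theta ^+ n.
  by apply: single M12 _ => //; rewrite !le_max lexx ?orbT.
have tb : ((nmsg n q1 * nmsg n q2)%N)%:R * (2 * rho hb ^+ n) <= 2 * 4 * theta ^+ n.
  by apply: single M12 _ => //; rewrite !le_max lexx ?orbT.
lra.
Unshelve. all: by end_near. Qed.

End achievable_rates.

(** * Gaussian tails *)

Section Qfun_theory.
Context {R : realType}.

Lemma QfunE (x : R) : ((Qfun x)%:E = normal_prob 0 1 `[x, +oo[)%E.
Proof.
have h := @probability_le1 _ _ R (normal_prob 0 1) `[x, +oo[ (measurable_itv _).
rewrite -[RHS]fineK; last by rewrite ge0_fin_numE// (le_lt_trans h)// ltry.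
congr (fine _)%:E; apply: eq_integral => t _; congr EFin.
rewrite normal_pdfE ?oner_neq0// /normal_peak /normal_fun expr1n mul1r.
by rewrite subr0.
Qed.

Lemma Qfun_ge0 (x : R) : 0 <= Qfun x.
Proof. by rewrite -lee_fin QfunE. Qed.

(** Markov's inequality for [exp (z^2 / 4)], whose mean [sqrt 2] is at most 2. *)
Lemma Qfun_le (x : R) : 0 <= x -> Qfun x <= 2 * expR (- (x ^+ 2 / 4)).
Proof.
move=> x0; rewrite expRN ler_pdivlMr ?expR_gt0// mulrC.
pose f (z : R) := expR (1 / 4 * ((z - 0) / 1) ^+ 2).
have mf : measurable_fun [set: R] f.
  apply: measurableT_comp => //; apply: measurable_funM => //.
  by apply: measurable_funX; apply: measurable_funM => //; exact: measurable_funB.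
have half : 2 * (1 / 4) < 1 :> R by lra.
have Ef := @normal_prob_expR_sqr R 0 1 (1 / 4) ltr01 half.
have : ((expR (x ^+ 2 / 4) * Qfun x)%:E <= ((Num.sqrt (1 - 2 * (1 / 4)))^-1)%:E)%E.
  rewrite -Ef EFinM QfunE.
  have <- : (\int[normal_prob 0 1]_(z in `[x, +oo[) (expR (x ^+ 2 / 4))%:E =
      (expR (x ^+ 2 / 4))%:E * normal_prob 0 1 `[x, +oo[)%E.
    exact: (@integral_cst _ _ R (normal_prob 0 1) _
      (measurable_itv `[x, +oo[) (expR (x ^+ 2 / 4))%:E).
  rewrite integral_mkcond; apply: ge0_le_integral => //.
  - by move=> z _; rewrite patchE; case: ifP => // _; rewrite lee_fin expR_ge0.
  - by apply/(measurable_restrictT _ _).1 => //; exact: measurable_cst.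
  - exact/measurable_EFinP.
  move=> z _; rewrite patchE; case: ifPn => [|_]; last by rewrite lee_fin expR_ge0.
  rewrite inE /= in_itv/= andbT => xz; rewrite lee_fin ler_expR subr0 divr1.
  have : x ^+ 2 <= z ^+ 2 by rewrite ler_sqr ?nnegrE// (le_trans x0).
  lra.
rewrite lee_fin => /le_trans; apply.
rewrite invf_ple ?posrE ?sqrtr_gt0//; last lra.
rewrite -[leLHS]ger0_norm ?invr_ge0// -sqrtr_sqr ler_wsqrtr//.
by rewrite expr2; lra.
Qed.

Lemma expR_sqr_le (x : R) : 0 < x -> expR (- (x ^+ 2 / 4)) <= 4 / x ^+ 2.
Proof.
move=> x0; have x20 : 0 < x ^+ 2 by rewrite exprn_gt0.
rewrite expRN -[leRHS]invrK lef_pV2 ?posrE ?expR_gt0 ?invr_gt0 ?divr_gt0//.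
by rewrite invf_div; have := expR_ge1Dx (x ^+ 2 / 4); lra.
Qed.

(** With [xi = rho * sigma] these two quantities are the error terms in [xi / sigma] of both
    objectives, so one [rho] serves every signal-to-noise ratio. *)
Lemma gauss_tail_small (del : R) : 0 < del ->
  exists rho : R, [/\ 0 < rho, Qfun rho <= del & rho * expR (- rho ^+ 2 / 2) <= del].
Proof.
move=> del0; pose m := Num.min del 1; have m0 : 0 < m by rewrite lt_min del0 ltr01.
have m1 : m <= 1 by rewrite ge_min lexx orbT.
have md : m <= del by rewrite ge_min lexx.
have r0 : 0 < 8 / m by rewrite divr_gt0.
have e1 := expR_sqr_le r0.
have e8 : 4 / (8 / m) ^+ 2 = m ^+ 2 / 16 by field; rewrite gt_eqF.
rewrite e8 in e1.
exists (8 / m); split => //.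
  apply: (le_trans (Qfun_le (ltW r0))); apply: le_trans md; nra.
have -> : - (8 / m) ^+ 2 / 2 = - ((8 / m) ^+ 2 / 4) + - ((8 / m) ^+ 2 / 4) by field; rewrite gt_eqF.
rewrite expRD.
have ee0 : 0 < expR (- ((8 / m) ^+ 2 / 4)) by exact: expR_gt0.
set E := expR _ in e1 ee0 *.
apply: (@le_trans _ _ (8 / m * (m ^+ 2 / 16 * (m ^+ 2 / 16)))).
  by rewrite ler_wpM2l ?(ltW r0)// ler_pM// ltW.
rewrite (_ : 8 / m * (m ^+ 2 / 16 * (m ^+ 2 / 16)) = m * (m ^+ 2 / 32));
  last by field; rewrite gt_eqF.
apply: le_trans md; nra.
Qed.

End Qfun_theory.

(** * Upper bounds on the capacity expressions *)

Section capacity_bound.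
Context {R : realType}.

(** [inf] of a set without lower bound is 0 by convention, whence the maximum. *)
Lemma inf_le_max (S : set R) (x : R) : S x -> inf S <= Num.max 0 x.
Proof.
move=> Sx; have [lS|nlS] := pselect (has_lbound S).
  by rewrite le_max (inf_lbound lS Sx) orbT.
by rewrite inf_out ?le_max ?lexx// => -[].
Qed.

Lemma ln2_gt0 : 0 < ln 2 :> R.
Proof. by rewrite ln_gt0//; lra. Qed.

Lemma ln_div_le (a b : R) : 0 < a -> 0 <= b <= 1 / 4 -> ln (a / (1 - 2 * b)) <= ln a + 4 * b.
Proof.
move=> a0 /andP[b0 b4]; have p : 0 < 1 - 2 * b by lra.
rewrite lnM ?posrE ?invr_gt0// lerD2l.
have -> : (1 - 2 * b)^-1 = 1 + 2 * b / (1 - 2 * b) by field; rewrite gt_eqF.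
have q : 0 <= 2 * b / (1 - 2 * b) by rewrite divr_ge0 ?mulr_ge0// ltW.
apply: (le_trans (le_ln1Dx _)); first by lra.
by rewrite ler_pdivrMr//; nra.
Qed.

(** Raising the weight [w] to 1 requires a nonnegative logarithm, hence [1 <= x]. *)
Lemma objective_le (w x T a b : R) : w <= 1 -> 1 <= x -> ln x <= a -> T <= b ->
  w * log2 x + log2 (expR 1) * T <= (a + b) / ln 2.
Proof.
move=> w1 x1 xa Tb; have l2 := ln2_gt0.
rewrite /log2 expRK div1r mulrDl lerD//.
- rewrite mulrA ler_wpM2r ?invr_ge0 ?(ltW l2)//; apply: le_trans xa.
  by rewrite ler_piMl// ln_ge0.
- by rewrite mulrC ler_wpM2r ?invr_ge0 ?(ltW l2).
Qed.

Lemma sqrt2pi_ge1 : 1 <= Num.sqrt (pi *+ 2) :> R.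
Proof.
have pi2 := @pi_ge2 R; rewrite -[leLHS]sqrtr1; apply: ler_wsqrtr.
by rewrite mulr2n; lra.
Qed.

Lemma log2_snr_factor (alpha mu zeta K : R) : 0 < zeta -> 0 < K ->
  log2 (snr_factor alpha mu zeta * K) =
  (ln (K * zeta / Num.sqrt (pi *+ 2)) + mu * alpha - 1 / 2) / ln 2.
Proof.
move=> z0 K0; have c0 := @sqrt2pi_gt0 R; rewrite /log2 /snr_factor.
congr (_ / _); set c := Num.sqrt _ in c0 *.
have -> : zeta * expR (mu * alpha) / (c * expR (1 / 2)) * K =
    K * zeta / c * expR (mu * alpha - 1 / 2).
  by rewrite expRB; field; rewrite !gt_eqF ?expR_gt0.
by rewrite lnM ?posrE ?expR_gt0 ?divr_gt0 ?mulr_gt0// expRK addrA.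
Qed.

Lemma ler_div_ge1 (x c del : R) : 0 <= del -> 1 <= c -> x <= del -> x / c <= del.
Proof.
move=> d0 c1 xd; have c0 : 0 < c by exact: lt_le_trans c1.
by rewrite ler_pdivrMr// (le_trans xd)// ler_peMr.
Qed.

Lemma log_argument_le (y r del Q : R) : 1 <= y -> 1 <= r <= 1 + del ->
  0 <= Q <= del -> del <= 1 / 4 ->
  1 <= y * r / (1 - 2 * Q) /\ ln (y * r / (1 - 2 * Q)) <= ln y + del + 4 * del.
Proof.
move=> y1 /andP[r1 rd] /andP[Q0 Qd] d4.
have y0 : 0 < y by exact: lt_le_trans y1.
have r0 : 0 < r by exact: lt_le_trans r1.
have Q1 : 0 < 1 - 2 * Q by lra.
split.
  rewrite ler_pdivlMr// mul1r (@le_trans _ _ 1)//; first lra.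
  by rewrite (le_trans y1)// ler_peMr// ltW.
apply: (le_trans (ln_div_le _ _)); first by rewrite mulr_gt0.
  by rewrite Q0 (le_trans Qd).
apply: lerD; last by rewrite ler_wpM2l.
rewrite lnM ?posrE// lerD2l -[X in ln X](subrK 1) addrC.
by apply: (le_trans (le_ln1Dx _)); lra.
Qed.

(** The middle term is the numerator in the logarithm of [c1_obj], with [tau = mu * xi / A] and
    [E = expR (- mu)]; it tends to [1 - E] as [xi / A] vanishes. *)
Lemma tilted_range_le (E tau del : R) : 0 < E -> 0 < tau -> 0 < del <= 1 / 4 ->
  3 * tau <= del * (1 - E) ->
  1 - E <= expR tau - E * expR (- tau) <= (1 - E) * (1 + del).
Proof.
move=> E0 t0 /andP[d0 d1] t3.
have y0 : 0 < 1 - E by rewrite -(pmulr_rgt0 _ d0); lra.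
have t4 : tau <= 1 / 12.
  have : del * (1 - E) <= 1 / 4 * 1 by apply: ler_pM; lra.
  by lra.
have et1 : expR tau <= 1 + 2 * tau.
  have t2 : tau <= 1 / 2 by lra.
  by apply: (le_trans (expR_le_quadratic t2)); nra.
have et2 := expR_ge1Dx (- tau).
have et3 := expR_ge1Dx tau.
have et4 : expR (- tau) <= 1 by rewrite -[leRHS]expR0 ler_expR oppr_le0 ltW.
by apply/andP; split; nra.
Qed.

(** Of the [7 * del], five come from the logarithm and one each from [Qfun rho] and
    [rho * expR (- rho ^+ 2 / 2)]. *)
Lemma c2_obj_le (s A alpha rho del : R) : 0 < s -> 0 < A -> 0 < rho ->
  0 < del <= 1 / 4 -> Qfun rho <= del -> rho * expR (- rho ^+ 2 / 2) <= del ->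
  Num.sqrt (pi *+ 2) <= A / s -> 2 * rho / del <= A / s ->
  c2_obj s A (rho * s) <=
  log2 (snr_factor alpha 0 1 * (A / s)) + 7 * del / ln 2.
Proof.
move=> s0 A0 rho0 /andP[d0 d1] Qd rd K1 K2.
have c0 := @sqrt2pi_gt0 R; have c1 := sqrt2pi_ge1; have l2 := ln2_gt0.
have K0 : 0 < A / s by rewrite divr_gt0.
rewrite log2_snr_factor// mul0r addr0 mulr1 -mulrDl /c2_obj mulfK ?gt_eqF//.
set c := Num.sqrt _ in c0 c1 K1 *.
set Q := Qfun rho in Qd *; have Q0 : 0 <= Q by exact: Qfun_ge0.
have Q2 : 0 < 1 - 2 * Q by lra.
have xE : (A + 2 * (rho * s)) / (s * c * (1 - 2 * Q)) =
    A / s / c * (1 + 2 * rho / (A / s)) / (1 - 2 * Q).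
  by field; rewrite !gt_eqF.
have Kc1 : 1 <= A / s / c by rewrite ler_pdivlMr// mul1r.
have r1 : 1 <= 1 + 2 * rho / (A / s) <= 1 + del.
  rewrite lerDl lerD2l divr_ge0 ?(ltW K0) ?mulr_ge0 ?(ltW rho0)//=.
  by rewrite ler_pdivrMr// [leRHS]mulrC -ler_pdivrMr.
have Q01 : 0 <= Q <= del by rewrite Q0.
have [x1 lnx] := log_argument_le Kc1 r1 Q01 d1.
apply: (le_trans (objective_le (a := ln (A / s / c) + del + 4 * del)
  (b := - (1 / 2) + 2 * del) _ _ _ _)).
- by rewrite gerBl mulr_ge0// Qfun_ge0.
- by rewrite xE.
- by rewrite xE.
- have -> : - (rho * s) ^+ 2 / (2 * s ^+ 2) = - rho ^+ 2 / 2 by field; rewrite gt_eqF.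
  have -> : rho * s / (c * s) * expR (- rho ^+ 2 / 2) = rho * expR (- rho ^+ 2 / 2) / c.
    by field; rewrite !gt_eqF.
  by have := ler_div_ge1 (ltW d0) c1 rd; clear - Qd; lra.
by rewrite ler_wpM2r ?invr_ge0 ?(ltW l2)//; lra.
Qed.

(** The term [mu * alpha] of the objective matches the factor [expR (mu * alpha)] of [snr_factor].
    The eighth [del] pays for the term in [s / A]. *)
Lemma c1_obj_le (s A alpha mu rho del : R) : 0 < s -> 0 < A -> 0 < alpha ->
  0 < rho -> 0 < mu ->
  0 < del <= 1 / 4 -> Qfun rho <= del -> rho * expR (- rho ^+ 2 / 2) <= del ->
  Num.sqrt (pi *+ 2) / ((1 - expR (- mu)) / mu) <= A / s ->
  3 * mu * rho / (del * (1 - expR (- mu))) <= A / s -> mu / del <= A / s ->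
  c1_obj s A alpha mu (rho * s) <=
  log2 (snr_factor alpha mu ((1 - expR (- mu)) / mu) * (A / s)) + 8 * del / ln 2.
Proof.
move=> s0 A0 al0 rho0 mu0 d01 Qd rd K1 K2 K3; have /andP[d0 d1] := d01.
have c0 := @sqrt2pi_gt0 R; have c1 := sqrt2pi_ge1; have l2 := ln2_gt0.
have K0 : 0 < A / s by rewrite divr_gt0.
have E0 := expR_gt0 (- mu).
have E1 : expR (- mu) < 1 by rewrite -[ltRHS]expR0 ltr_expR oppr_lt0.
set E := expR (- mu) in E0 E1 K1 K2 *.
have y0 : 0 < 1 - E by rewrite subr_gt0.
pose z := (1 - E) / mu; have z0 : 0 < z by rewrite divr_gt0.
rewrite log2_snr_factor// -mulrDl /c1_obj mulfK ?gt_eqF//.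
set c := Num.sqrt _ in c0 c1 K1 *.
set Q := Qfun rho in Qd *; have Q0 : 0 <= Q by exact: Qfun_ge0.
have Q2 : 0 < 1 - 2 * Q by clear - Qd d1; lra.
pose tau := mu * (rho * s) / A.
have tau0 : 0 < tau by rewrite divr_gt0 ?mulr_gt0.
have tau3 : 3 * tau <= del * (1 - E).
  have -> : 3 * tau = 3 * mu * rho / (A / s) by rewrite /tau; field; rewrite !gt_eqF.
  by rewrite ler_pdivrMr// [leRHS]mulrC -ler_pdivrMr// mulr_gt0.
have -> : - (mu * (1 + rho * s / A)) = - mu + - tau by rewrite /tau; ring.
rewrite -/tau expRD -/E.
have /andP[Dge Dle] := tilted_range_le E0 tau0 d01 tau3.
set Dl := expR tau - E * expR (- tau) in Dge Dle *.
have xE : A / s * (Dl / (c * mu * (1 - 2 * Q))) =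
    A / s * z / c * (Dl / (1 - E)) / (1 - 2 * Q).
  by rewrite /z; field; rewrite !gt_eqF.
have Kc1 : 1 <= A / s * z / c by rewrite ler_pdivlMr// mul1r -ler_pdivrMr.
have r1 : 1 <= Dl / (1 - E) <= 1 + del.
  by rewrite ler_pdivlMr// ler_pdivrMr// mul1r Dge mulrC.
have Q01 : 0 <= Q <= del by rewrite Q0.
have [x1 lnx] := log_argument_le Kc1 r1 Q01 d1.
apply: (le_trans (objective_le (a := ln (A / s * z / c) + del + 4 * del)
  (b := - (1 / 2) + 3 * del + mu * alpha) _ _ _ _)).
- by rewrite -addrA -opprD gerBl addr_ge0 ?Qfun_ge0.
- by rewrite xE.
- by rewrite xE.
- have -> : - (rho * s) ^+ 2 / (2 * s ^+ 2) = - rho ^+ 2 / 2 by field; rewrite gt_eqF.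
  have -> : rho * s / (c * s) * expR (- rho ^+ 2 / 2) = rho * expR (- rho ^+ 2 / 2) / c.
    by field; rewrite !gt_eqF.
  have a1 := ler_div_ge1 (ltW d0) c1 rd.
  have a2 : s / A * (mu / c) * (expR (- rho ^+ 2 / 2) -
      expR (- (A + rho * s) ^+ 2 / (2 * s ^+ 2))) <= del.
    have -> : s / A * (mu / c) = mu / (A / s) / c by field; rewrite !gt_eqF.
    have m1 : mu / (A / s) <= del by rewrite ler_pdivrMr// [leRHS]mulrC -ler_pdivrMr.
    apply: le_trans (ler_div_ge1 (ltW d0) c1 m1).
    rewrite ler_piMr//; first by rewrite !divr_ge0// ltW.
    rewrite lerBlDr (@le_trans _ _ 1) ?lerDl ?expR_ge0//.
    by rewrite -[leRHS]expR0 ler_expR mulNr oppr_le0 divr_ge0 ?sqr_ge0.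
  have a3 : mu * alpha * (1 - 2 * Qfun ((rho * s + A / 2) / s)) <= mu * alpha.
    rewrite ler_piMr ?mulr_ge0 ?(ltW mu0) ?(ltW al0)//.
    by rewrite gerBl mulr_ge0// Qfun_ge0.
  by clear - Qd a1 a2 a3; lra.
by rewrite ler_wpM2r ?invr_ge0 ?(ltW l2)// -/z; clear; lra.
Qed.

End capacity_bound.

(** * Choice of the input law and its match with the capacity bound *)

Section tilt_existence.
Context {R : realType}.

Lemma small_parameter (b : R) : 0 < b -> exists del, 0 < del <= 1 / 4 /\ 8 * del <= b.
Proof.
move=> b0; exists (Num.min (1 / 4) (b / 8)).
split; first by rewrite lt_min ge_min lexx !divr_gt0.
have : Num.min (1 / 4) (b / 8) <= b / 8 by rewrite ge_min lexx orbT.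
lra.
Qed.

(** The maximum with 0 disappears once [L * (A / s) >= 1]. *)
Lemma Cbar_le_of_obj (alpha mu zeta eps K0 : R) : 0 < zeta -> 0 < eps ->
  (forall A s : R, 0 < A -> 0 < s -> K0 <= A / s ->
     Cbar s A alpha <= Num.max 0 (log2 (snr_factor alpha mu zeta * (A / s)) + eps)) ->
  exists K, forall A s : R, 0 < A -> 0 < s -> K <= A / s ->
    Cbar s A alpha <= log2 (snr_factor alpha mu zeta * (A / s)) + eps.
Proof.
move=> z0 eps0 H; set L := snr_factor _ _ _ in H *.
have L0 : 0 < L by rewrite divr_gt0 ?mulr_gt0 ?expR_gt0 ?sqrt2pi_gt0.
exists (Num.max K0 L^-1) => A s A0 s0; rewrite ge_max => /andP[K1 K2].
apply: (le_trans (H A s A0 s0 K1)); rewrite ge_max lexx andbT.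
rewrite addr_ge0 ?(ltW eps0)// divr_ge0 ?(ltW ln2_gt0)// ln_ge0//.
by rewrite -ler_pdivrMl// mulr1.
Qed.

Lemma Cbar_le_uniform (alpha eps : R) : 1 / 2 <= alpha -> 0 < eps ->
  exists K, forall A s : R, 0 < A -> 0 < s -> K <= A / s ->
    Cbar s A alpha <= log2 (snr_factor alpha 0 1 * (A / s)) + eps.
Proof.
move=> al eps0; have l2 := @ln2_gt0 R.
have [del [/andP[d0 d1] del_eps]] := small_parameter (mulr_gt0 eps0 l2).
have [rho [rho0 Qd rd]] := gauss_tail_small d0.
apply: (@Cbar_le_of_obj _ _ _ _ (Num.max (Num.sqrt (pi *+ 2)) (2 * rho / del))) => //.
move=> A s A0 s0; rewrite ge_max => /andP[K1 K2].
rewrite /Cbar ltNge al /=.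
apply: (@le_trans _ _ (Num.max 0 (c2_obj s A (rho * s)))).
  by apply: inf_le_max; exists (rho * s); rewrite mulr_gt0.
rewrite ge_max !le_max lexx /=; apply/orP; right.
have dd : 0 < del <= 1 / 4 by rewrite d0.
apply: (le_trans (c2_obj_le alpha s0 A0 rho0 dd Qd rd K1 K2)).
rewrite lerD2l ler_pdivrMr//; lra.
Qed.

Lemma Cbar_le_tilted (alpha mu eps : R) : 0 < alpha -> alpha < 1 / 2 -> 0 < mu -> 0 < eps ->
  exists K, forall A s : R, 0 < A -> 0 < s -> K <= A / s ->
    Cbar s A alpha <=
    log2 (snr_factor alpha mu ((1 - expR (- mu)) / mu) * (A / s)) + eps.
Proof.
move=> al0 al mu0 eps0; have l2 := @ln2_gt0 R.
have E1 : expR (- mu) < 1 by rewrite -[ltRHS]expR0 ltr_expR oppr_lt0.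
have z0 : 0 < (1 - expR (- mu)) / mu by rewrite divr_gt0 ?subr_gt0.
have [del [/andP[d0 d1] del_eps]] := small_parameter (mulr_gt0 eps0 l2).
have [rho [rho0 Qd rd]] := gauss_tail_small d0.
apply: (@Cbar_le_of_obj _ _ _ _ (Num.max (Num.sqrt (pi *+ 2) / ((1 - expR (- mu)) / mu))
  (Num.max (3 * mu * rho / (del * (1 - expR (- mu)))) (mu / del)))) => //.
move=> A s A0 s0; rewrite !ge_max => /and3P[K1 K2 K3].
rewrite /Cbar al /=.
apply: (@le_trans _ _ (Num.max 0 (c1_obj s A alpha mu (rho * s)))).
  by apply: inf_le_max; exists mu, (rho * s); rewrite mulr_gt0.
rewrite ge_max !le_max lexx /=; apply/orP; right.
have dd : 0 < del <= 1 / 4 by rewrite d0.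
apply: (le_trans (c1_obj_le s0 A0 al0 rho0 mu0 dd Qd rd K1 K2 K3)).
rewrite lerD2l ler_pdivrMr//; lra.
Qed.

(** With equal weights the mean is [(N - 1) / (2 N)], below 1/2. *)
Lemma tilt_uniform (alpha : R) : 1 / 2 <= alpha -> tilt alpha 0 1.
Proof.
move=> al; split => // N N0 x.
have NR0 : (0 : R) < N%:R by rewrite ltr0n.
have ZE : partition_fun x 0 = N%:R.
  rewrite /partition_fun; under eq_bigr do rewrite mul0r oppr0 expR0.
  by rewrite sumr_const card_ord.
split; rewrite ?ZE ?mulr1 ?mul0r//.
rewrite /tilted_mean ZE; under eq_bigr do rewrite mul0r oppr0 expR0 mul1r.
rewrite -mulr_suml !ler_pdivrMr//; apply: (@le_trans _ _ (1 / 2 * N%:R * N%:R)); last first.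
  by rewrite !ler_pM2r.
move: (N) => M; elim: M => [|M IH]; first by rewrite big_ord0 !mulr0.
by rewrite big_ord_recr/= -[M.+1%:R]natr1; nra.
Qed.

(* The hypothesis on [alpha] says that the density proportional to
   [exp (- mu x)] on [0, 1] has mean [alpha]. *)
Lemma tilt_exponential (alpha mu : R) : 0 < mu ->
  alpha = mu^-1 - expR (- mu) / (1 - expR (- mu)) ->
  tilt alpha mu ((1 - expR (- mu)) / mu).
Proof.
move=> mu0 alE; set E := expR (- mu) in alE *.
have E1 : E < 1 by rewrite -[ltRHS]expR0 ltr_expR oppr_lt0.
have y0 : 0 < 1 - E by rewrite subr_gt0.
split; [exact: ltW|by rewrite divr_gt0|move=> N N0 x].
have NR0 : (0 : R) < N%:R by rewrite ltr0n.
pose t := mu / N%:R; have t0 : 0 < t by rewrite divr_gt0.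
pose q := expR (- t).
have q0 : 0 < q by exact: expR_gt0.
have q1 : q < 1 by rewrite -[ltRHS]expR0 ltr_expR oppr_lt0.
have p0 : 0 < 1 - q by rewrite subr_gt0.
have qN : q ^+ N = E.
  by rewrite -expRM_natl /E; congr expR; rewrite /t; field; rewrite gt_eqF.
have qk (k : 'I_N) : expR (- (mu * x k)) = q ^+ k.
  by rewrite -expRM_natl; congr expR; rewrite /x /t; field; rewrite gt_eqF.
have S0 M : (1 - q) * (\sum_(k < M) q ^+ k) = 1 - q ^+ M.
  elim: M => [|M IH]; first by rewrite big_ord0 mulr0 expr0 subrr.
  by rewrite big_ord_recr/= mulrDr IH exprS; ring.
have S1 M : (1 - q) * (\sum_(k < M) q ^+ k * k%:R) =
    q * (\sum_(k < M) q ^+ k) - M%:R * q ^+ M.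
  elim: M => [|M IH]; first by rewrite !big_ord0 !mulr0 mul0r subrr.
  by rewrite !big_ord_recr/= mulrDr IH -natr1 exprS; ring.
have ZE : partition_fun x mu = (1 - E) / (1 - q).
  rewrite /partition_fun; under eq_bigr do rewrite qk.
  by rewrite -qN -S0 [RHS]mulrC mulKf ?gt_eqF.
have mE : tilted_mean x mu = q / (N%:R * (1 - q)) - E / (1 - E).
  rewrite /tilted_mean ZE; under eq_bigr do rewrite qk /x mulrA.
  rewrite -mulr_suml.
  have -> : \sum_(k < N) q ^+ k * k%:R = (q * ((1 - E) / (1 - q)) - N%:R * E) / (1 - q).
    apply: (mulfI (lt0r_neq0 p0)).
    rewrite S1 qN; have := S0 N; rewrite qN => S0N.
    have -> : \sum_(k < N) q ^+ k = (1 - E) / (1 - q).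
      by rewrite -S0N mulrC mulKf ?gt_eqF.
    by field; rewrite gt_eqF.
  by field; rewrite !gt_eqF.
have tE : mu^-1 = (N%:R * t)^-1 by congr _^-1; rewrite /t; field; rewrite gt_eqF.
have Nt0 : 0 < N%:R * t by exact: mulr_gt0.
have Np0 : 0 < N%:R * (1 - q) by exact: mulr_gt0.
(* With the geometric sums in closed form, all three claims reduce to
   [1 - t <= q <= 1 / (1 + t)]. *)
have qle : 1 - t <= q by rewrite -[1 - t]/(1 + - t) expR_ge1Dx.
have qge : q * (1 + t) <= 1.
  by rewrite -[leRHS](expRxMexpNx_1 t) mulrC ler_wpM2r ?(ltW q0)// expR_ge1Dx.
split.
- rewrite ZE ler_pdivlMr//.
  have -> : N%:R * ((1 - E) / mu) * (1 - q) = (1 - E) * ((1 - q) / t).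
    by rewrite /t; field; rewrite !gt_eqF.
  rewrite ler_piMr ?(ltW y0)// ler_pdivrMr//; lra.
- rewrite mE alE lerD2r tE.
  rewrite ler_pdivrMr//.
  have -> : (N%:R * t)^-1 * (N%:R * (1 - q)) = (1 - q) / t by field; rewrite !gt_eqF.
  by rewrite ler_pdivlMr//; lra.
- rewrite ler_pM2l// mE alE tE addrAC lerD2r.
  have -> : (N%:R * t)^-1 - N%:R^-1 = (1 - t) / (N%:R * t) by field; rewrite !gt_eqF.
  rewrite ler_pdivrMr//.
  have -> : q / (N%:R * (1 - q)) * (N%:R * t) = q * t / (1 - q) by field; rewrite !gt_eqF.
  by rewrite ler_pdivlMr//; nra.
Qed.

Lemma expR_ge_quadratic (x : R) : 0 <= x -> 1 + x + x ^+ 2 / 2 <= expR x.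
Proof.
move=> x0; have nd : nondecreasing_seq (series (exp_coeff x)).
  by apply: nondecreasing_series => n _ _; rewrite /exp_coeff/= divr_ge0 ?exprn_ge0.
have := nondecreasing_cvgn_le nd (is_cvg_series_exp_coeff x) 3.
apply: le_trans; rewrite /series /exp_coeff /= !big_nat_recr//= big_geq//.
by rewrite expr0 expr1 !divr1 add0r.
Qed.

Lemma exponential_mean_surjective (alpha : R) : 0 < alpha < 1 / 2 ->
  exists2 mu, 0 < mu & alpha = mu^-1 - expR (- mu) / (1 - expR (- mu)).
Proof.
move=> /andP[al0 al1].
(* [mu * (1 - expR (- mu))] times the difference of the mean and [alpha]: clearing denominators
   makes continuity immediate. *)
pose f (mu : R) := 1 - expR (- mu) * (1 + mu) - alpha * (mu * (1 - expR (- mu))).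
(* The mean behaves like [1 / 2 - mu / 12] for small [mu] and still exceeds [alpha] at [a]; it is at
   most [1 / mu], which is [alpha / 2] at [b]. *)
pose a := 1 / 2 - alpha; pose b := 2 / alpha.
have a0 : 0 < a by rewrite /a; lra.
have b4 : 4 <= b by rewrite /b ler_pdivlMr//; lra.
have cE : continuous (fun mu : R => expR (- mu)).
  move=> z; apply: continuous_comp; first exact: opp_continuous.
  exact: continuous_expR.
have cf : continuous f.
  move=> z; rewrite /f; apply: cvgB; [apply: cvgB; first exact: cvg_cst|].
    by apply: cvgM; [exact: cE|apply: cvgD; [exact: cvg_cst|exact: cvg_id]].
  apply: cvgM; first exact: cvg_cst.
  by apply: cvgM; [exact: cvg_id|apply: cvgB; [exact: cvg_cst|exact: cE]].
(* The terms of order [a^2] cancel in [f a], so the first-order bound [expR (- a) <= 1 / (1 + a)]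
   would be too weak. *)
have fa : 0 <= f a.
  have e1 := @expR_ge1Dx R (- a).
  have e2 := @expR_ge_quadratic a (ltW a0).
  rewrite /f; have -> : alpha = 1 / 2 - a by rewrite /a; lra.
  have a1 : a < 1 / 2 by rewrite /a; lra.
  set F := 1 + a + a ^+ 2 / 2 in e2 *.
  have F0 : 0 < F by have := sqr_ge0 a; rewrite /F; lra.
  have e3 : expR (- a) <= F^-1 by rewrite expRN lef_pV2 ?posrE ?expR_gt0.
  have e4 : F^-1 * (1 + a) = 1 - a ^+ 2 / 2 * F^-1.
    by rewrite /F; field; rewrite gt_eqF//; have := sqr_ge0 a; lra.
  have e5 : 1 - a - a ^+ 2 / 2 <= F^-1.
    rewrite -[leRHS]div1r ler_pdivlMr// /F; nra.
  move: (expR (- a)) (F^-1) e1 e3 e4 e5 => e G e1 e3 e4 e5.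
  have e6 : e * (1 + a) <= G * (1 + a) by rewrite ler_wpM2r//; lra.
  have e7 : (1 / 2 - a) * (a * (1 - e)) <= (1 / 2 - a) * (a * a).
    by rewrite ler_wpM2l ?ler_wpM2l ?(ltW a0)//; lra.
  have e8 : a ^+ 2 / 2 * (1 - a - a ^+ 2 / 2) <= a ^+ 2 / 2 * G.
    by rewrite ler_wpM2l// divr_ge0// sqr_ge0.
  have : 0 <= a ^+ 2 * (a / 2 - a ^+ 2 / 4).
    by rewrite mulr_ge0 ?sqr_ge0//; nra.
  by lra.
have fb : f b <= 0.
  rewrite /f mulrA (_ : alpha * b = 2); last by rewrite /b mulrC divfK ?gt_eqF.
  have := expR_gt0 (- b); move: (expR _) => e e0; nra.
have ab : a <= b by rewrite /a; lra.
have [mu /= + fmu] : exists2 mu, mu \in `[a, b] & f mu = 0.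
  apply: IVT => //; first exact: continuous_subspaceT.
  by rewrite ge_min fb orbT le_max fa.
rewrite in_itv/= => /andP[amu _]; have mu0 : 0 < mu by exact: lt_le_trans amu.
exists mu => //.
have E1 : expR (- mu) < 1 by rewrite -[ltRHS]expR0 ltr_expR oppr_lt0.
move: fmu; rewrite /f; move: (expR _) E1 => E E1 fmu.
have y0 : 0 < 1 - E by rewrite subr_gt0.
apply: (mulfI (lt0r_neq0 (mulr_gt0 mu0 y0))).
rewrite (_ : mu * (1 - E) * (mu^-1 - E / (1 - E)) = 1 - E * (1 + mu)); last first.
  by field; rewrite !gt_eqF.
lra.
Qed.

Lemma tilt_and_capacity (alpha : R) : 0 < alpha ->
  exists mu zeta : R, tilt alpha mu zeta /\ forall eps, 0 < eps ->
    exists K, forall A s : R, 0 < A -> 0 < s -> K <= A / s ->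
      Cbar s A alpha <= log2 (snr_factor alpha mu zeta * (A / s)) + eps.
Proof.
move=> al0; have [al|al] := leP (1 / 2) alpha.
  exists 0, 1; split; first exact: tilt_uniform.
  by move=> eps eps0; exact: Cbar_le_uniform.
have [|mu mu0 alE] := @exponential_mean_surjective alpha; first by rewrite al0.
exists mu, ((1 - expR (- mu)) / mu); split; first exact: tilt_exponential.
by move=> eps eps0; exact: Cbar_le_tilted.
Qed.

End tilt_existence.

(** * Sum-rate comparison under strong interference *)

Section strong_interference.
Context {R : realType}.

Lemma corr_strong (s A alpha hji hjj : R) : 0 < hjj -> hjj <= hji ->
  corr s A alpha hji hjj = 0.
Proof.
move=> h0 hh; rewrite /corr; apply/min_idPl.
rewrite mulr_ge0// divr_ge0 ?(ltW ln2_gt0)// ln_ge0// le_max; apply/orP; left.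
by rewrite ler_pdivlMr ?exprn_gt0// mul1r ler_sqr// nnegrE ltW// (lt_le_trans h0).
Qed.

Lemma powR2_lt (q x : R) : 0 < x -> q < log2 x -> 2 `^ q < x.
Proof.
move=> x0; rewrite /log2 ltr_pdivlMr ?ln2_gt0// => qx.
by rewrite /powR gt_eqF// -[ltRHS]lnK ?posrE// ltr_expR.
Qed.

Lemma le_log2 (x y : R) : 0 < x -> x <= y -> log2 x <= log2 y.
Proof.
move=> x0 xy; rewrite ler_wpM2r ?invr_ge0 ?(ltW ln2_gt0)//.
by rewrite ler_ln// posrE// (lt_le_trans x0).
Qed.

Lemma log2M2 (x : R) : 0 < x -> log2 (2 * x) = 1 + log2 x.
Proof. by move=> x0; rewrite /log2 lnM ?posrE// mulrDl divff ?gt_eqF ?ln2_gt0. Qed.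

(* [h + k <= 2 * max h k] costs one bit, which the two subtracted halves pay for.
   If one of the rates is clipped to zero, only one half remains; then the
   other rate is already below its own single-user bound, and [k' <= k]
   (strong interference) makes that bound smaller than [l (max h k)]. *)
Lemma truncated_sum_lt (l : R -> R) (R1 R2 h k k' eps : R) :
  (forall x y, 0 < x -> x <= y -> l x <= l y) ->
  (forall x, 0 < x -> l (2 * x) = 1 + l x) ->
  0 < eps -> 0 < h -> 0 < k' -> k' <= k ->
  Num.max 0 (R1 - 1 / 2 - eps) < l h -> Num.max 0 (R2 - 1 / 2 - eps) < l k' ->
  R1 + R2 <= l (h + k) + eps / 2 ->
  Num.max 0 (R1 - 1 / 2 - eps) + Num.max 0 (R2 - 1 / 2 - eps) < l (Num.max h k).
Proof.
move=> lmono ldbl eps0 h0 k'0 kk r1 r2 r12; set m := Num.max h k.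
have m0 : 0 < m by rewrite lt_max h0.
have lh : l h <= l m by apply: lmono => //; rewrite le_max lexx.
have lk : l k' <= l m by apply: lmono => //; rewrite le_max kk orbT.
have ls : l (h + k) <= 1 + l m.
  rewrite -ldbl//; apply: lmono.
    by rewrite addr_gt0// (lt_le_trans k'0).
  by rewrite mulr_natl mulr2n; apply: lerD; rewrite le_max lexx ?orbT.
have [r1n|r1p] := leP (R1 - 1 / 2 - eps) 0.
  by rewrite add0r; apply: lt_le_trans lk.
have [r2n|r2p] := leP (R2 - 1 / 2 - eps) 0.
  by rewrite addr0; move: r1; rewrite max_r ?(ltW r1p)// => r1; apply: lt_le_trans lh.
lra.
Qed.

End strong_interference.

Theorem theorem5 (R : realType) (h11 h12 h21 h22 alpha eps : R) :
  0 < h11 -> h11 <= h12 -> 0 < h22 -> h22 <= h21 ->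
  0 < alpha <= 1 -> 0 < eps ->
  exists K : R, forall A sigma : R, 0 < A -> 0 < sigma -> K <= A / sigma ->
    forall R1 R2 : R, GZ' h11 h12 h21 h22 sigma A alpha R1 R2 ->
      in_G h11 h12 h21 h22 sigma A alpha alpha (R1 - 1/2 - eps, R2 - 1/2 - eps).
Proof.
move=> h110 h1112 h220 h2221 /andP[al0 _] eps0.
have h120 : 0 < h12 by exact: lt_le_trans h1112.
have h210 : 0 < h21 by exact: lt_le_trans h2221.
have [mu [zeta [tlt Cbound]]] := tilt_and_capacity al0.
have [_ z0 _] := tlt.
(* Spending only [eps / 2] on the capacity bound leaves the other half to make the rate inequalities
   strict. *)
have [K0 {}Cbound] := Cbound (eps / 2) (divr_gt0 eps0 (ltr0Sn _ 1)).
set L := snr_factor alpha mu zeta in Cbound.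
have L0 : 0 < L by rewrite divr_gt0 ?mulr_gt0 ?expR_gt0 ?sqrt2pi_gt0.
(* The threshold [2 / L] makes [l h] positive, so that a rate clipped at 0 still obeys a strict
   bound. *)
pose K1 := Num.max K0 (2 / L).
have K10 : 0 < K1 by rewrite lt_max divr_gt0 ?orbT.
exists (Num.max (K1 / h11) (K1 / h22)) => A s A0 s0.
rewrite ge_max !ler_pdivrMr// => /andP[Kh11 Kh22] R1 R2.
have snr0 : 0 < A / s by rewrite divr_gt0.
rewrite /GZ' (corr_strong _ _ _ h220 h2221) (corr_strong _ _ _ h110 h1112) !subr0.
move=> [[R10 R20] C1 C2 C12 C21].
pose l h := log2 (L * (h * A / s)).
have Cl h : 0 < h -> K1 <= A / s * h -> Cbar s (h * A) alpha <= l h + eps / 2.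
  move=> h0; rewrite ge_max => /andP[K0h _]; apply: Cbound => //.
    by rewrite mulr_gt0.
  by rewrite -mulrA mulrC.
have pos h : 0 < h -> 0 < L * (h * A / s).
  by move=> h0; rewrite mulr_gt0// divr_gt0// mulr_gt0.
have lmono x y : 0 < x -> x <= y -> l x <= l y.
  move=> x0 xy; apply: le_log2; first exact: pos.
  by rewrite ler_wpM2l ?(ltW L0)// -!mulrA ler_wpM2r// ltW.
have ldbl x : 0 < x -> l (2 * x) = 1 + l x.
  by move=> x0; rewrite -log2M2 ?pos// /l; congr log2; ring.
have l_gt0 h : 0 < h -> K1 <= A / s * h -> 0 < l h.
  move=> h0; rewrite ge_max => /andP[_]; rewrite ler_pdivrMr// => Lh.
  rewrite divr_gt0 ?ln2_gt0// ln_gt0//.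
  have -> : L * (h * A / s) = A / s * h * L by ring.
  by apply: lt_le_trans Lh; lra.
have [K11 K22] : K1 <= A / s * (h11 + h21) /\ K1 <= A / s * (h22 + h12).
  split; [apply: le_trans Kh11 _|apply: le_trans Kh22 _];
  by rewrite ler_wpM2l ?(ltW snr0)// lerDl ltW.
(* Clipping gives the nonnegative rates that [achievable_rates] requires; a pair with a negative
   coordinate is dominated by the clipped one. *)
pose q1 := Num.max 0 (R1 - 1/2 - eps); pose q2 := Num.max 0 (R2 - 1/2 - eps).
have q1l : q1 < l h11.
  rewrite gt_max l_gt0//=.
  by have := Cl _ h110 Kh11; move: C1 eps0; lra.
have q2l : q2 < l h22.
  rewrite gt_max l_gt0//=.
  by have := Cl _ h220 Kh22; move: C2 eps0; lra.
have q12l : q1 + q2 < l (Num.max h11 h21).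
  apply: (@truncated_sum_lt _ l R1 R2 h11 h21 h22) => //.
  by apply: (le_trans C12); apply: Cl => //; rewrite addr_gt0.
have q21l : q1 + q2 < l (Num.max h22 h12).
  rewrite addrC.
  apply: (@truncated_sum_lt _ l R2 R1 h22 h12 h11) => //.
  by rewrite addrC; apply: (le_trans C21); apply: Cl => //; rewrite addr_gt0.
have max_or (x y : R) : Num.max x y = x \/ Num.max x y = y.
  by case: (leP x y); [right|left].
have ach : achievable h11 h12 h21 h22 s A alpha alpha q1 q2.
  apply: (achievable_rates (ha := Num.max h11 h21) (hb := Num.max h22 h12)
    h110 h120 h210 h220 s0 A0 al0 tlt); rewrite ?le_max ?lexx//.
  - exact: powR2_lt (pos _ h110) q1l.
  - exact: powR2_lt (pos _ h220) q2l.
  - by apply: powR2_lt q12l; apply: pos; rewrite lt_max h110.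
  - by apply: powR2_lt q21l; apply: pos; rewrite lt_max h220.
have inG : capacity_region h11 h12 h21 h22 s A alpha alpha (q1, q2).
  exact: subset_closure.
have [r1|r1] := ltP (R1 - 1/2 - eps) 0.
  right; split; first by left.
  by exists (q1, q2); split => //; rewrite !le_max !lexx !orbT.
have [r2|r2] := ltP (R2 - 1/2 - eps) 0.
  right; split; first by right.
  by exists (q1, q2); split => //; rewrite !le_max !lexx !orbT.
by left; move: inG; rewrite /q1 /q2 !max_r.
Qed.
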